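(* Let $\gamma\in\,]0,1[$ with $\gamma^{-1}\notin\mathbb N$ and $N=\lfloor\gamma^{-1}\rfloor$. There is an action $(g,X)\mapsto gX$ of the additive group $\mathcal C^\gamma$ on the set $\mathbf{BRP}^\gamma$ of branched $\gamma$-rough paths such that (a) if $g=(g^\tau)_{\tau\in\mathcal T_N}\in\mathcal C^\gamma$ has exactly one $\tau\in\mathcal T_N$ with $g^\tau\not\equiv0$, then for this $\tau$ and all $X\in\mathbf{BRP}^\gamma$, $\langle (gX)_{st},\tau\rangle=\langle X_{st},\tau\rangle+g^\tau_t-g^\tau_s$ for all $s,t\in[0,1]$, and $\langle gX,\sigma\rangle=\langle X,\sigma\rangle$ for all $\sigma\in\mathcal T$ not containing $\tau$; (b) for every given branched $\gamma$-rough path $X$, the map $g\mapsto gX$ is a bijection from $\mathcal C^\gamma$ onto the set $\mathbf{BRP}^\gamma$ of branched $\gamma$-rough paths.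
   Context: Fix $d\ge1$. $\mathcal T$ is the set of non-empty non-planar rooted trees with nodes decorated by $\{1,\dots,d\}$; $\mathcal F$ is the set of forests (finite multisets of elements of $\mathcal T$, including the empty forest $\mathbf 1$); $|\tau|$ is the number of nodes of $\tau$; $\mathcal T_n=\{\tau\in\mathcal T:|\tau|\le n\}$. $\mathcal H$ is the real vector space spanned by $\mathcal F$, with commutative product given by disjoint union of forests (unit $\mathbf 1$), and with the Butcher--Connes--Kreimer coproduct: the unique algebra morphism $\Delta:\mathcal H\to\mathcal H\otimes\mathcal H$ with $\Delta[\tau]_i=[\tau]_i\otimes\mathbf 1+(\mathrm{id}\otimes[\cdot]_i)\Delta\tau$, where for a forest $\tau=\tau_1\cdots\tau_k$, $[\tau]_i$ denotes the tree obtained by grafting $\tau_1,\dots,\tau_k$ onto a new root decorated by $i$. $G$ is the set of characters of $\mathcal H$, i.e. nonzero linear maps $X:\mathcal H\to\mathbb R$ with $\langle X,\tau\sigma\rangle=\langle X,\tau\rangle\langle X,\sigma\rangle$; it is a group under $\langle X\star Y,\tau\rangle=\langle X\otimes Y,\Delta\tau\rangle$. A branched $\gamma$-rough path is a map $X:[0,1]^2\to G$ such that $X_{su}\star X_{ut}=X_{st}$ for all $s,u,t\in[0,1]$ and, for every $\tau\in\mathcal F$, there is a constant $C_\tau$ with $|\langle X_{st},\tau\rangle|\le C_\tau|t-s|^{\gamma|\tau|}$ for all $s,t\in[0,1]$. $\mathbf{BRP}^\gamma$ is the set of all of them. For $\beta\in\,]0,1[$, $C^\beta([0,1])$ is the space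 of real $\beta$-Hölder functions on $[0,1]$. $\mathcal C^\gamma$ is the set of families $(g^\tau)_{\tau\in\mathcal T_N}$ with $g^\tau\in C^{\gamma|\tau|}([0,1])$ and $g^\tau_0=0$, an abelian group under pointwise addition. A tree $\sigma\in\mathcal T$ contains $\tau\in\mathcal T$ if there is a subtree (connected subgraph) $\tau'$ of $\sigma$, not necessarily containing the root of $\sigma$, such that $\tau$ and $\tau'$ are isomorphic as decorated rooted trees, the root of $\tau'$ being its node closest to the root of $\sigma$. *)

(* Defs.v *)
From HB Require Import structures.
From mathcomp Require Import all_boot all_order all_algebra.
From mathcomp Require Import finmap monalg.
From mathcomp Require Import boolp functions reals exp.

Set Implicit Arguments.
Unset Strict Implicit.
Unset Printing Implicit Defensive.

Import Order.TTheory GRing.Theory Num.Theory.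

Local Open Scope ring_scope.

Inductive ptree (d : nat) := Node of 'I_d & seq (ptree d).

Section PlanarTrees.
Variable d : nat.
Implicit Types t : ptree d.

Definition root_label t : 'I_d := let: Node i _ := t in i.
Definition children t : seq (ptree d) := let: Node _ s := t in s.

Fixpoint ptree_all_ind (P : ptree d -> Prop)
    (H : forall i s, foldr (fun t Q => P t /\ Q) True s -> P (Node i s)) t : P t :=
  match t with
  | Node i s => H i s
     ((fix rec (s : seq (ptree d)) : foldr (fun t Q => P t /\ Q) True s :=
         match s with
         | [::] => I
         | u :: s' => conj (ptree_all_ind H u) (rec s')
         end) s)
  end.

Fixpoint ptree_encode t : GenTree.tree 'I_d :=
  let: Node i s := t in GenTree.Node 0 (GenTree.Leaf i :: map ptree_encode s).

Fixpoint ptree_decode (c : GenTree.tree 'I_d) : option (ptree d) :=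
  if c is GenTree.Node _ (GenTree.Leaf i :: s)
  then Some (Node i (pmap ptree_decode s)) else None.

Lemma ptree_encodeK : pcancel ptree_encode ptree_decode.
Proof.
elim/ptree_all_ind => i s IH /=; congr (Some (Node _ _)).
by elim: s IH => //= u s IHs [-> /IHs ->].
Qed.

HB.instance Definition _ := Countable.copy (ptree d) (pcan_type ptree_encodeK).

(* An arbitrary total order on planar trees, only used to choose one planar
   representative of each non-planar tree. *)
Definition ptree_le : rel (ptree d) := relpre choice.pickle leq.

Fixpoint ptree_sorted t : bool :=
  let: Node _ s := t in sorted ptree_le s && all ptree_sorted s.

(* The nodes of a tree are encoded by their addresses: [::] is the root, and
   k :: p is the node of address p in the k-th child of the root. *)
Fixpoint addresses t : seq (seq nat) :=
  let: Node _ s := t in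
  [::] :: flatten [seq map (cons kp.1) kp.2
                  | kp <- zip (iota 0 (size s)) (map addresses s)].

Fixpoint ptree_at t (p : seq nat) : ptree d :=
  if p is k :: p' then ptree_at (nth t (children t) k) p' else t.

End PlanarTrees.

(* Non-planar trees: a planar tree in which the children of every node are
   sorted, i.e. exactly one representative of each class of planar trees up to
   reordering of children. *)
Record tree (d : nat) := Tree { tree_val : ptree d; _ : ptree_sorted tree_val }.

HB.instance Definition _ d := [isSub for @tree_val d].
HB.instance Definition _ d := [Countable of tree d by <:].

Definition forest (d : nat) := {cmonom (tree d)}.

HB.instance Definition _ d := ConomialDef.on (forest d).

Identity Coercion forest_cmonom : forest >-> cmonom.

Section Trees.
Variable d : nat.
Implicit Types (t : tree d) (f : forest d).

Definition tree1 t : forest d := ucm t.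

Definition forest_of (s : seq (tree d)) : forest d :=
  \big[mmul/mone]_(t <- s) tree1 t.

Definition seq_of_forest f : seq (tree d) :=
  flatten [seq nseq (f t) t | t <- finsupp f].

Definition tree_le : rel (tree d) := relpre val (@ptree_le d).

Lemma tree_le_total : total tree_le.
Proof. by move=> x y; exact: leq_total. Qed.

Lemma graft_subproof (i : 'I_d) f :
  ptree_sorted (Node i (map val (sort tree_le (seq_of_forest f)))).
Proof.
rewrite /= sorted_map sort_sorted ?all_map; last exact: tree_le_total.
by apply/allP=> -[].
Qed.

(* [f]_i: the trees of f are grafted onto a new root decorated by i *)
Definition graft (i : 'I_d) f : tree d := Tree (graft_subproof i f).

Fixpoint tree_of_ptree (p : ptree d) : tree d :=
  let: Node i s := p in graft i (forest_of (map tree_of_ptree s)).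

Definition tree_size t : nat := size (addresses (val t)).

Definition forest_size f : nat := (\sum_(t <- finsupp f) f t * tree_size t)%N.

Definition node t := seq_sub (addresses (val t)).

Definition node_label t (v : node t) : 'I_d :=
  root_label (ptree_at (val t) (val v)).

Definition depth t (v : node t) : nat := size (val v).

Definition is_child t (u v : node t) : bool :=
  prefix (val u) (val v) && (depth v == (depth u).+1).

Definition adjacent t : rel (node t) := fun u v => is_child u v || is_child v u.

Definition connected_nodes t (S : {set node t}) : Prop :=
  S != set0 /\
  {in S &, forall u v, connect [rel x y | [&& x \in S, y \in S & adjacent x y]] u v}.

(* phi is an isomorphism of decorated rooted trees from tau onto the subtree of
   sigma with set of nodes S, rooted at its node closest to the root of sigma *)
Definition rooted_iso (tau sigma : tree d) (S : {set node sigma})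
    (phi : node tau -> node sigma) : Prop :=
  [/\ injective phi, phi @: [set: node tau] = S,
      forall u v, adjacent (phi u) (phi v) = adjacent u v,
      forall u, node_label (phi u) = node_label u
    & forall r, depth r = 0 -> {in S, forall v, depth (phi r) <= depth v}]%N.

Definition contains (sigma tau : tree d) : Prop :=
  exists S : {set node sigma},
    connected_nodes S /\ exists phi : node tau -> node sigma, rooted_iso S phi.

End Trees.

(* K * L indexes the basis x (x) y of the tensor product of the algebras with
   bases K and L, whose product is (x (x) y) (x' (x) y') = xx' (x) yy' *)
Section PairMonomial.
Variables K L : conomType.

Definition pair_one : K * L := (mone, mone).
Definition pair_mul (x y : K * L) : K * L := (mmul x.1 y.1, mmul x.2 y.2).

Fact pair_mulA : associative pair_mul.
Proof. by move=> x y z; rewrite /pair_mul /= !mulmA. Qed.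
Fact pair_mul1m : left_id pair_one pair_mul.
Proof. by case=> x y; rewrite /pair_mul /= !mul1m. Qed.
Fact pair_mulm1 : right_id pair_one pair_mul.
Proof. by case=> x y; rewrite /pair_mul /= !mulm1. Qed.
Fact pair_mulC : commutative pair_mul.
Proof. by move=> x y; rewrite /pair_mul [mmul x.1 _]mulmC [mmul x.2 _]mulmC. Qed.
Fact pair_unitm x y : pair_mul x y = pair_one -> x = pair_one /\ y = pair_one.
Proof.
by case: x y => [a b] [a' b'] [] /unitm [-> ->] /unitm [-> ->].
Qed.

HB.instance Definition _ := Choice_isMonomialDef.Build (K * L)%type
  pair_mulA pair_mul1m pair_mulm1 pair_unitm.
HB.instance Definition _ := MonomialDef_isConomialDef.Build (K * L)%type pair_mulC.

End PairMonomial.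

(* The basis element of {malg R[K]} given by k; locked because deciding
   << k >> = << l >> by conversion does not terminate in reasonable time. *)
HB.lock Definition basis (R : nzRingType) (K : choiceType) (k : K) : {malg R[K]} :=
  << k >>.
Canonical basis_unlockable := Unlockable basis.unlock.

Arguments basis {R K} k.

Section LinearExtension.
Variables (R : comNzRingType) (K : choiceType) (V : lmodType R) (h : K -> V).

Definition linext (x : {malg R[K]}) : V := \sum_(k <- msupp x) x@_k *: h k.

Lemma linextEw (D : {fset K}) x : (msupp x `<=` D)%fset ->
  linext x = \sum_(k <- D) x@_k *: h k.
Proof.
move=> sD; rewrite /linext; apply: big_fset_incl => // k _ /mcoeff_outdom ->.
by rewrite scale0r.
Qed.

Lemma linext_is_linear : linear linext.
Proof.
move=> a x y; set D := (msupp (a *: x + y) `|` msupp x `|` msupp y)%fset.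
have sD z : (msupp z `<=` D)%fset -> linext z = \sum_(k <- D) z@_k *: h k.
  exact: linextEw.
rewrite !sD /D ?fsubsetUr //; last first.
- by rewrite -fsetUA fsubsetUl.
- by rewrite fsetUAC fsubsetUr.
rewrite scaler_sumr -big_split /=; apply: eq_bigr => k _.
by rewrite mcoeffD mcoeffZ scalerDl scalerA.
Qed.

HB.instance Definition _ :=
  GRing.isLinear.Build R {malg R[K]} V *:%R linext linext_is_linear.

Lemma linextU k : linext (basis k) = h k.
Proof.
rewrite unlock.
by rewrite (linextEw (D := [fset k])%fset) ?msuppU_le // big_seq_fset1 mcoeffUU scale1r.
Qed.

End LinearExtension.

Section TreeLemmas.
Variable d : nat.
Implicit Types (t : tree d) (f : forest d).

Lemma forest_ofE (s : seq (tree d)) t : forest_of s t = count_mem t s.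
Proof.
rewrite /forest_of; elim: s => [|u s IH]; first by rewrite big_nil cm1.
by rewrite big_cons cmM cmU IH /= eq_sym.
Qed.

Lemma count_seq_of_forest f t : count_mem t (seq_of_forest f) = f t.
Proof.
rewrite /seq_of_forest count_flatten -map_comp sumnE big_map.
transitivity (\sum_(u <- finsupp f) (u == t) * f u)%N.
  by apply: eq_bigr => u _; rewrite /= count_nseq.
have [tf|tNf] := boolP (t \in finsupp f).
  rewrite (big_fsetD1 t) //= eqxx mul1n big_seq big1 ?addn0 // => u.
  by rewrite !inE => /andP[/negbTE->].
rewrite big_seq big1 => [|u uf]; first by case: finsuppP tNf.
by case: eqP uf => // ->; rewrite (negbTE tNf).
Qed.

Lemma perm_seq_of_forest (s : seq (tree d)) : perm_eq (seq_of_forest (forest_of s)) s.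
Proof. by apply/allP => t _ /=; rewrite count_seq_of_forest forest_ofE. Qed.

Lemma forest_of_eq (s1 s2 : seq (tree d)) :
  perm_eq s1 s2 -> forest_of s1 = forest_of s2.
Proof. by move=> /permP s12; apply/eqP/cmP => t; rewrite !forest_ofE. Qed.

Lemma seq_of_forestK f : forest_of (seq_of_forest f) = f.
Proof. by apply/eqP/cmP => t; rewrite forest_ofE count_seq_of_forest. Qed.

Lemma ptree_le_anti : antisymmetric (@ptree_le d).
Proof.
by move=> x y /anti_leq; exact: (pcan_inj choice.pickleK).
Qed.

Lemma tree_of_ptreeK t : tree_of_ptree (val t) = t.
Proof.
apply: val_inj; case: t => p /=; elim/ptree_all_ind: p => i s IH /= /andP[ss sa].
congr Node; set us := map _ s; have usE : map val us = s.
  rewrite /us; elim: s IH sa {ss us} => //= u s IHs [Hu Hs] /andP[su sa].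
  by rewrite Hu // IHs.
have sus : sorted (@tree_le d) us by rewrite -usE sorted_map in ss.
rewrite -[RHS]usE; congr map.
apply: (@sorted_eq _ (@tree_le d)) => //.
- by move=> x y z; exact: leq_trans.
- by move=> x y /ptree_le_anti /val_inj.
- exact/sort_sorted/tree_le_total.
- by rewrite perm_sort perm_seq_of_forest.
Qed.

Lemma tree_graft_ind (P : tree d -> Prop) :
    (forall i (s : seq (tree d)), (forall t, t \in s -> P t) ->
       P (graft i (forest_of s))) ->
  forall t, P t.
Proof.
move=> H t; rewrite -(tree_of_ptreeK t).
elim/ptree_all_ind: (val t) => i s IH /=; apply: H.
elim: s IH => //= u s IHs [Hu Hs] v; rewrite inE => /orP[/eqP->//|].
exact: IHs.
Qed.

End TreeLemmas.

Notation bck R d := {malg R[forest d]}.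
Notation bck2 R d := {malg R[(forest d * forest d)%type]}.

Section Coproduct.
Variables (R : comNzRingType) (d : nat).

(* id (x) [.]_i *)
Definition graft_right (i : 'I_d) : bck2 R d -> bck2 R d :=
  linext (fun m => basis (m.1, tree1 (graft i m.2))).

Fixpoint coproduct_ptree (p : ptree d) : bck2 R d :=
  let: Node i s := p in
  basis (tree1 (tree_of_ptree p), mone) +
  graft_right i (\prod_(x <- map coproduct_ptree s) x).

Definition coproduct_forest (f : forest d) : bck2 R d :=
  \prod_(t <- finsupp f) coproduct_ptree (val t) ^+ f t.

Definition coproduct : bck R d -> bck2 R d := linext coproduct_forest.

HB.instance Definition _ i := GRing.Linear.on (graft_right i).
HB.instance Definition _ := GRing.Linear.on coproduct.

Lemma coproduct_forestEw (D : {fset tree d}) (f : forest d) : (finsupp f `<=` D)%fset ->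
  coproduct_forest f = \prod_(t <- D) coproduct_ptree (val t) ^+ f t.
Proof.
by move=> sD; apply: big_fset_incl => // t _ tNf; case: finsuppP tNf => // _ _.
Qed.

Lemma coproduct_forest1 : coproduct_forest mone = 1.
Proof. by rewrite /coproduct_forest mdom1 big_seq_fset0. Qed.

Lemma coproduct_forestM f1 f2 :
  coproduct_forest (mmul f1 f2) = coproduct_forest f1 * coproduct_forest f2.
Proof.
set D := (finsupp f1 `|` finsupp f2)%fset.
rewrite !(@coproduct_forestEw D) ?fsubsetUl ?fsubsetUr ?mdomD //.
by rewrite -big_split; apply: eq_bigr => t _; rewrite cmM exprD.
Qed.

Lemma coproduct_forestU t : coproduct_forest (tree1 t) = coproduct_ptree (val t).
Proof. by rewrite /coproduct_forest mdomU big_seq_fset1 cmUU expr1. Qed.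

Lemma basis1 (K : monomType) : basis mone = 1 :> {malg R[K]}.
Proof. by rewrite unlock. Qed.

Lemma basisM (K : monomType) (x y : K) : basis (mmul x y) = basis x * basis y :> {malg R[K]}.
Proof. by rewrite unlock malgM_def fgmulUU mulr1. Qed.

Lemma malgZU (K : choiceType) (a : R) (k : K) : << a *g k >> = a *: basis k :> {malg R[K]}.
Proof. by apply/malgP => l; rewrite unlock mcoeffZ !mcoeffU mulrnAr mulr1. Qed.

Lemma malg_linE (K : choiceType) (V : lmodType R) (D : {linear {malg R[K]} -> V}) x :
  D x = \sum_(k <- msupp x) x@_k *: D (basis k).
Proof.
rewrite {1}[x]monalgE linear_sum; apply: eq_bigr => k _.
by rewrite malgZU linearZ.
Qed.

Lemma malg_lin_ext (K : choiceType) (V : lmodType R) (D E : {linear {malg R[K]} -> V}) :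
  (forall k, D (basis k) = E (basis k)) -> D =1 E.
Proof. by move=> DE x; rewrite !malg_linE; apply: eq_bigr => k _; rewrite DE. Qed.

Lemma malg_mulP (K : monomType) (A : algType R) (D : {linear {malg R[K]} -> A}) :
  (forall x y, D (basis (mmul x y)) = D (basis x) * D (basis y)) ->
  {morph D : x y / x * y}.
Proof.
move=> DM x y; rewrite [D x]malg_linE [D y]malg_linE mulr_suml malgME linear_sum.
apply: eq_bigr => k _; rewrite mulr_sumr linear_sum; apply: eq_bigr => l _.
by rewrite -scalerAl -scalerAr scalerA -DM malgZU linearZ.
Qed.

Lemma coproductU (f : forest d) : coproduct (basis f) = coproduct_forest f.
Proof. exact: linextU. Qed.

Lemma coproduct_is_monoid_morphism : monoid_morphism coproduct.
Proof.
split; first by rewrite -basis1 coproductU coproduct_forest1.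
by apply: malg_mulP => x y; rewrite /= !coproductU coproduct_forestM.
Qed.

HB.instance Definition _ :=
  GRing.isMonoidMorphism.Build (bck R d) (bck2 R d) coproduct
    coproduct_is_monoid_morphism.

Lemma coproduct_graft i f :
  coproduct (basis (tree1 (graft i f))) =
  basis (tree1 (graft i f), mone) + graft_right i (coproduct (basis f)).
Proof.
rewrite !coproductU coproduct_forestU.
set us := sort (@tree_le d) (seq_of_forest f).
have fE : forest_of us = f.
  by rewrite -[RHS]seq_of_forestK; apply/forest_of_eq; rewrite /us perm_sort.
have -> : coproduct_ptree (val (graft i f)) =
    basis (tree1 (tree_of_ptree (val (graft i f))), mone) +
    graft_right i (\prod_(x <- map coproduct_ptree (map val us)) x) by [].
rewrite tree_of_ptreeK.
congr (_ + graft_right i _); rewrite -map_comp big_map.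
rewrite -[f in RHS]fE /forest_of -/us (big_morph _ coproduct_forestM coproduct_forest1).
by apply: eq_bigr => t _; rewrite coproduct_forestU.
Qed.

Lemma coproduct_unique (D : {lrmorphism bck R d -> bck2 R d}) :
    (forall i f, D (basis (tree1 (graft i f))) =
       basis (tree1 (graft i f), mone) + graft_right i (D (basis f))) ->
  D =1 coproduct.
Proof.
move=> DE; apply: malg_lin_ext.
have ext (s : seq (tree d)) :
    (forall t, t \in s -> D (basis (tree1 t)) = coproduct (basis (tree1 t))) ->
  D (basis (forest_of s)) = coproduct (basis (forest_of s)).
  rewrite /forest_of; elim: s => [|t s IH] Hs; first by rewrite big_nil basis1 !rmorph1.
  rewrite big_cons basisM !rmorphM /= IH => [|u us]; first by rewrite Hs ?mem_head.
  by apply: Hs; rewrite inE us orbT.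
have tE t : D (basis (tree1 t)) = coproduct (basis (tree1 t)).
  elim/tree_graft_ind: t => i s IH.
  by rewrite DE coproduct_graft ext.
by move=> f; rewrite -[f]seq_of_forestK; apply: ext.
Qed.

End Coproduct.

Section Characters.
Variables (R : realType) (d : nat).

Record character := Character {
  char_form :> {scalar bck R d};
  _ : exists x, char_form x != 0;
  _ : {morph char_form : x y / x * y} }.

Implicit Types X Y : character.

Lemma characterM X : {morph X : x y / x * y}. Proof. by case: X. Qed.

Lemma character1 X : X 1 = 1.
Proof.
case: X => f [x fx] fM /=; apply: (mulIf fx).
by rewrite -fM !mul1r.
Qed.

Lemma character_ext X Y : X =1 Y -> X = Y.
Proof.
case: X Y => [f nf mf] [g ng mg] /= fg; have {}fg : f = g.
  case: f g fg {nf mf ng mg} => [f [[f1] [f2]]] [g [[g1] [g2]]] /= /funext fg.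
  by subst g; rewrite (Prop_irrelevance f1 g1) (Prop_irrelevance f2 g2).
by subst g; rewrite (Prop_irrelevance nf ng) (Prop_irrelevance mf mg).
Qed.

(* X (x) Y *)
Definition tensor X Y : bck2 R d -> R^o :=
  linext (fun m => (X (basis m.1) * Y (basis m.2) : R^o)).

HB.instance Definition _ X Y := GRing.Linear.on (tensor X Y).

Lemma tensorM X Y : {morph tensor X Y : x y / x * y}.
Proof.
apply: malg_mulP => x y; rewrite /= /tensor !linextU /=.
by rewrite !basisM !characterM mulrACA.
Qed.

Definition star_fun X Y (x : bck R d) : R := tensor X Y (coproduct x).

Lemma star_fun_is_linear X Y : linear_for *%R (star_fun X Y).
Proof. by move=> a x y; rewrite /star_fun !linearP. Qed.

HB.instance Definition _ X Y :=
  GRing.isLinear.Build R (bck R d) R *%R (star_fun X Y) (star_fun_is_linear X Y).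

Lemma star_neq0 X Y : exists x, star_fun X Y x != 0.
Proof.
exists 1; rewrite /star_fun rmorph1 -basis1 /tensor linextU /= !basis1.
by rewrite !character1 mulr1 oner_neq0.
Qed.

Lemma star_mul X Y : {morph star_fun X Y : x y / x * y}.
Proof. by move=> x y; rewrite /star_fun rmorphM /= tensorM. Qed.

Definition star X Y : character :=
  @Character (star_fun X Y) (star_neq0 X Y) (@star_mul X Y).

End Characters.

Definition unit_interval (R : realType) := {x : R | x \in `[0, 1]}.

Section RoughPaths.
Variables (R : realType) (d : nat) (gamma : R).

Lemma zero_in_unit_interval : (0 : R) \in `[0, 1].
Proof. by rewrite in_itv /= lexx ler01. Qed.

Definition unit_interval0 : unit_interval R := exist _ 0 zero_in_unit_interval.

Record branched_rough_path := BranchedRoughPath {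
  brp_val :> unit_interval R -> unit_interval R -> character R d;
  _ : forall s u t, star (brp_val s u) (brp_val u t) = brp_val s t;
  _ : forall f : forest d, exists C : R, forall s t,
        `|brp_val s t (basis f)|
        <= C * `|val t - val s| `^ (gamma * (forest_size f)%:R) }.

Definition holder (beta : R) (f : unit_interval R -> R) : Prop :=
  exists C : R, forall s t, `|f t - f s| <= C * `|val t - val s| `^ beta.

(* T_N with N = floor (gamma^-1) *)
Definition trees_upto := {tau : tree d | (tree_size tau <= Num.truncn gamma^-1)%N}.

Definition holder_family : {pred trees_upto -> unit_interval R -> R} :=
  [pred g | `[< forall tau : trees_upto,
     holder (gamma * (tree_size (val tau))%:R) (g tau) /\ g tau unit_interval0 = 0 >]].

Lemma holder_family_zmod_closed : zmod_closed holder_family.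
Proof.
split=> [|g h]; rewrite !inE.
  apply/asboolP => tau; split=> //; exists 0 => s t.
  by rewrite subrr normr0 mul0r.
move=> /asboolP Hg /asboolP Hh; apply/asboolP => tau.
have [[C HC] g0] := Hg tau; have [[D HD] h0] := Hh tau.
split; last by rewrite [LHS](_ : _ = g tau unit_interval0 - h tau unit_interval0) // g0 h0 subrr.
exists (C + D) => s t; rewrite mulrDl.
have ghE r : (g - h) tau r = g tau r - h tau r by [].
have -> : (g - h) tau t - (g - h) tau s = (g tau t - g tau s) - (h tau t - h tau s).
  by rewrite !ghE !opprB addrACA [RHS]addrACA; congr (_ + _); exact: addrC.
by apply: le_trans (ler_normB _ _) _; apply: lerD.
Qed.

HB.instance Definition _ :=
  GRing.isZmodClosed.Build (trees_upto -> unit_interval R -> R) holder_family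
    holder_family_zmod_closed.

Record holder_group := HolderGroup {
  hg_val :> trees_upto -> unit_interval R -> R;
  _ : hg_val \in holder_family }.

HB.instance Definition _ := [isSub for hg_val].
HB.instance Definition _ := [Choice of holder_group by <:].
HB.instance Definition _ := [SubChoice_isSubZmodule of holder_group by <:].

End RoughPaths.

(* Main.v *)
(** Tree by tree, a branched rough path x satisfies Chen's relation
    x_st = x_su + x_ut + W_sut, where W_sut = (X_su (x) X_ut) applied to the reduced
    coproduct of the tree depends only on the values of x on strictly smaller trees
    embedded in it. Coassociativity makes W a cocycle, of order |t - s|^a with
    a = gamma |tau| <> 1, so that, whether a < 1 or a > 1, a dyadic construction
    gives a function e of Hoelder order a with e_st = e_su + e_ut + W_sut. Choose one
    such e as a function of W only. Then x - e is additive and of Hoelder order a,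
    hence the increment of a Hoelder function g^tau, which vanishes if a > 1.
    By induction on the trees, X |-> (g^tau) is a bijection from rough paths to the
    Hoelder group, and the addition of the latter is transported to an action. *)

Require Import Defs.
From HB Require Import structures.
From mathcomp Require Import all_boot all_order all_algebra.
From mathcomp Require Import finmap monalg.
From mathcomp Require Import boolp classical_sets functions reals topology.
From mathcomp Require Import normedtype sequences exp.
From mathcomp Require Import lra ring.

Set Implicit Arguments.
Unset Strict Implicit.
Unset Printing Implicit Defensive.

Import Order.TTheory GRing.Theory Num.Theory.
Import numFieldNormedType.Exports.
Import Defs.

Local Open Scope ring_scope.

(** * Dyadic integration of additive cocycles *)

(** Above order 1 the sewing equation has a unique solution of the required order; below 1 it still
    has solutions but far from a unique one, and this freedom is what the functions g^tau
    parametrise. At order 1 neither of the two dyadic schemes keeps a geometric bound; the orders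
    that occur are gamma |tau|, and the hypothesis on gamma^-1 excludes the value 1. Once the
    bijection is there, the group laws and (b) are formal, whereas (a) depends on how it is built: a
    change of g^tau must propagate only to trees containing tau. The terms of the coproduct come
    with maps between addresses, while containment speaks of connected sets of nodes; the
    combinatorics below serves to pass from the former to the latter. *)

Section Geometric.
Variable R : realType.

Lemma geometric_vanish (x C r : R) : 0 <= r < 1 ->
  (forall j, `|x| <= C * r ^+ j) -> x = 0.
Proof.
move=> /andP[r0 r1] xC; have [//|x0] := eqVneq x 0.
have C0 : 0 < C.
  by have := xC 0%N; rewrite expr0 mulr1; apply: lt_le_trans; rewrite normr_gt0.
have /cvgr0Pnorm_lt : (((r ^+ n) @[n --> \oo]) --> 0)%classic.
  by apply: cvg_expr; rewrite ger0_norm.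
move=> /(_ (`|x| / C)) []; first by rewrite divr_gt0 ?normr_gt0.
move=> j _ /(_ j (leqnn j)) /=.
rewrite ger0_norm ?exprn_ge0 // ltr_pdivlMr // mulrC => /lt_le_trans /(_ (xC j)).
by rewrite ltxx.
Qed.

(** With [c j] the tail of the majorising geometric series, the intervals from [u j - c j] to
    [u j + c j] are nested; the limit is the supremum of their left ends. *)
Lemma geometric_limit (u : nat -> R) (C r : R) : 0 <= r < 1 ->
  (forall j, `|u j.+1 - u j| <= C * r ^+ j) ->
  exists l, forall j, `|u j - l| <= C / (1 - r) * r ^+ j.
Proof.
move=> /andP[r0 r1] uC; set c := fun j => C / (1 - r) * r ^+ j.
have r1' : 1 - r != 0 by rewrite subr_eq0 eq_sym lt_eqF.
have cE j : c j - c j.+1 = C * r ^+ j by rewrite /c exprS; field.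
have C0 : 0 <= C by have := uC 0%N; rewrite expr0 mulr1; apply: le_trans.
have c0 j : 0 <= c j by rewrite !mulr_ge0 ?exprn_ge0 // invr_ge0 subr_ge0 ltW.
have lo : {homo (fun j => u j - c j) : j k / (j <= k)%N >-> j <= k}.
  apply: homo_leq => [x|y x z|j]; [exact: lexx|exact: le_trans|].
  by have := uC j; rewrite -cE ler_norml => /andP[? ?]; lra.
have hi : {homo (fun j => u j + c j) : j k / (j <= k)%N >-> k <= j}.
  apply: (@homo_leq _ _ (fun x y => y <= x)) => [x|y x z|j].
  - exact: lexx.
  - by move=> xy yz; apply: le_trans yz xy.
  - by have := uC j; rewrite -cE ler_norml => /andP[? ?]; lra.
have lohi j k : u j - c j <= u k + c k.
  have := lo _ _ (leq_maxl j k); have := hi _ _ (leq_maxr j k).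
  by have := c0 (maxn j k); lra.
exists (sup (range (fun j => u j - c j))) => j; rewrite ler_norml; apply/andP; split.
  suff : sup (range (fun j => u j - c j)) <= u j + c j by rewrite /c; lra.
  by apply: ge_sup => [|_ [k _ <-]]; [exists (u 0%N - c 0%N), 0%N|].
suff : u j - c j <= sup (range (fun j => u j - c j)) by rewrite /c; lra.
apply: ub_le_sup; last by exists j.
by exists (u 0%N + c 0%N) => _ [k _ <-].
Qed.

(** [E m k] plays the increment over the [k]-th dyadic interval of level [m], and [V m k] the defect
    at its midpoint. For q = 2^-a, the two cases of the proof are a > 1 and a < 1. *)
Lemma dyadic_family (V : nat -> nat -> R) (K q : R) : 0 < q < 1 -> 2 * q != 1 ->
  (forall m k, `|V m k| <= K * q ^+ m) ->
  exists (E : nat -> nat -> R) (M : R),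
    (forall m k, E m k = V m k + E m.+1 k.*2 + E m.+1 k.*2.+1) /\
    (forall m k, `|E m k| <= M * q ^+ m).
Proof.
move=> /andP[q0 q1] q2 VK.
have K0 : 0 <= K by have := VK 0%N 0%N; rewrite expr0 mulr1; apply: le_trans.
case: (ltgtP (2 * q) 1) q2 => // [q2|q2] _.
  (* The total contribution of level [m + j] decays like [(2 q) ^+ j]: sum all levels. *)
  pose D := fix D j m k : R := if j is j'.+1
    then V m k + D j' m.+1 k.*2 + D j' m.+1 k.*2.+1 else 0.
  have D1 j m k : `|D j.+1 m k - D j m k| <= K * q ^+ m * (2 * q) ^+ j.
    elim: j m k => [|j IH] m k; first by rewrite /= !addr0 subr0 mulr1.
    have -> : D j.+2 m k - D j.+1 m k =
        (D j.+1 m.+1 k.*2 - D j m.+1 k.*2) + (D j.+1 m.+1 k.*2.+1 - D j m.+1 k.*2.+1).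
      by rewrite /=; ring.
    apply: le_trans (ler_normD _ _) _; apply: le_trans (lerD (IH _ _) (IH _ _)) _.
    by rewrite !exprS le_eqVlt; apply/orP; left; apply/eqP; ring.
  have lim m k := @geometric_limit (fun j => D j m k) _ (2 * q) _ (fun j => D1 j m k).
  have q02 : 0 <= 2 * q < 1 by rewrite q2 mulr_ge0 ?ltW.
  pose E m k := projT1 (cid (lim q02 m k)).
  have EP m k j : `|D j m k - E m k| <= K * q ^+ m / (1 - 2 * q) * (2 * q) ^+ j.
    by rewrite /E; case: cid.
  exists E, (K / (1 - 2 * q)); split=> m k; last first.
    have := EP m k 0%N; rewrite /= sub0r normrN mulr1 => /le_trans; apply.
    by rewrite mulrAC.
  (* The truncations satisfy the recursion exactly, depth [j.+1] against depth [j], so the error in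
     the limit is below every term of a geometric sequence. *)
  apply/eqP; rewrite -subr_eq0; apply/eqP.
  apply: (@geometric_vanish _ (K * q ^+ m / (1 - 2 * q) * (2 * q)
     + K * q ^+ m.+1 / (1 - 2 * q) + K * q ^+ m.+1 / (1 - 2 * q)) _ q02) => j.
  have -> : E m k - (V m k + E m.+1 k.*2 + E m.+1 k.*2.+1) =
    - (D j.+1 m k - E m k) + (D j m.+1 k.*2 - E m.+1 k.*2)
    + (D j m.+1 k.*2.+1 - E m.+1 k.*2.+1) by rewrite /=; ring.
  rewrite 2![_ * (2 * q) ^+ j]mulrDl; apply: le_trans (ler_normD _ _) _; apply: lerD => //.
  apply: le_trans (ler_normD _ _) _; apply: lerD => //.
  by rewrite normrN -mulrA -exprS; apply: EP.
(* Halving: the recursion for [E m k] is solved by splitting evenly between the two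
   halves of the interval, and [1 / 2 < q] keeps the bound. *)
pose E := fix E m k : R := if m is m'.+1 then (E m' k./2 - V m' k./2) / 2 else 0.
have q20 : 0 < 2 * q - 1 by rewrite subr_gt0.
(* This constant M solves (M + K) / 2 = M q, so the induction reproduces it. *)
exists E, (K / (2 * q - 1)); split=> m k.
  by rewrite /= uphalf_double doubleK; field.
elim: m k => [|m IH] k; first by rewrite normr0 mulr1 divr_ge0 // ltW.
rewrite /= normrM [X in _ * X]ger0_norm ?invr_ge0 // ler_pdivrMr //.
apply: le_trans (ler_normB _ _) _; apply: le_trans (lerD (IH _) (VK _ _)) _.
rewrite -mulrDl exprS le_eqVlt; apply/orP; left; apply/eqP; field.
by rewrite gt_eqF.
Qed.

(* [f] is recovered from the partial sums of [E + W 0] along dyadic points, plus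
   [W 0] between the last dyadic point and [t]. *)
Lemma dyadic_integral (W : R -> R -> R -> R) (K q : R) : 0 < q < 1 -> 2 * q != 1 ->
  (forall s u t v, W s u t + W s t v = W u t v + W s u v) ->
  (forall m s u t, `|u - s| <= 2^-1 ^+ m -> `|t - u| <= 2^-1 ^+ m ->
     `|W s u t| <= K * q ^+ m) ->
  exists (f : R -> R) (C : R), forall m s t, 0 <= s -> 0 <= t ->
    `|t - s| <= 2^-1 ^+ m -> `|f t - f s - W 0 s t| <= C * q ^+ m.
Proof.
move=> q01 q2 cW WK; have /andP[q0 q1] := q01.
have h0 m : 0 < 2^-1 ^+ m :> R by rewrite exprn_gt0 // invr_gt0.
have hS m : 2^-1 ^+ m.+1 = 2^-1 ^+ m / 2 :> R by rewrite exprSr.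
pose p m k : R := k%:R * 2^-1 ^+ m.
have p_double m k : p m.+1 k.*2 = p m k.
  by rewrite /p hS -mul2n natrM; field.
have p_S m k : p m k.+1 = p m k + 2^-1 ^+ m by rewrite /p -natr1 mulrDl mul1r.
have [|E [M [ER EM]]] := @dyadic_family
    (fun m k => W (p m k) (p m.+1 k.*2.+1) (p m k.+1)) K q q01 q2.
  move=> m k; apply: WK; rewrite !p_S p_double hS; have := h0 m.
    by rewrite ler_norml; lra.
  by rewrite ler_norml; lra.
have K0 : 0 <= K.
  have := @WK 0%N 0 0 0; rewrite !subr0 normr0 ler01 mulr1.
  by move=> /(_ isT isT); apply: le_trans.
have M0 : 0 <= M by have := EM 0%N 0%N; rewrite mulr1; apply: le_trans.
pose F := fix F m k : R := if k is k'.+1 then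
  F m k' + (E m k' + W 0 (p m k') (p m k'.+1)) else 0.
(* The cocycle relation turns the recursion on [E] into the agreement of the partial sums at levels
   [m] and [m.+1]. *)
have F_double m k : F m.+1 k.*2 = F m k.
  elim: k => //= k ->; rewrite (ER m k) -doubleS !p_double.
  have := cW 0 (p m k) (p m.+1 k.*2.+1) (p m k.+1); lra.
pose kap m (t : R) := Num.truncn (t / 2^-1 ^+ m).
have kapP m t : 0 <= t -> p m (kap m t) <= t < p m (kap m t).+1.
  move=> t0; have := @truncn_itv R (t / 2^-1 ^+ m).
  rewrite divr_ge0 ?(ltW (h0 m)) // => /(_ isT) /andP[].
  by rewrite ler_pdivlMr ?h0 // ltr_pdivrMr ?h0 // => -> ->.
have kap_eq m t k : 0 <= t -> p m k <= t < p m k.+1 -> kap m t = k.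
  move=> t0 /andP[kt tk]; apply: truncn_def.
  by rewrite ler_pdivlMr ?h0 // ltr_pdivrMr ?h0 // kt.
have kapS m t : 0 <= t ->
    (kap m.+1 t = (kap m t).*2) \/ (kap m.+1 t = (kap m t).*2.+1).
  move=> t0; have /andP[a b] := kapP m _ t0.
  have [c|c] := ltP t (p m.+1 (kap m t).*2.+1); [left|right]; apply: kap_eq => //.
    by rewrite c p_double a.
  by rewrite c -doubleS p_double.
pose u t m := F m (kap m t) + W 0 (p m (kap m t)) t.
have near m t : 0 <= t -> `|t - p m (kap m t)| <= 2^-1 ^+ m.
  by move=> /(kapP m) /andP[]; rewrite p_S ler_norml => ? ?; apply/andP; split; lra.
(* Refining the level changes nothing if [t] lies in the left half of its dyadic interval, and adds
   one [E] and one [W] over short intervals if it lies in the right half. *)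
have uS t m : 0 <= t -> `|u t m.+1 - u t m| <= (M + K) * q ^+ m.
  move=> t0; rewrite /u; have near1 := near m.+1 _ t0; have near0 := near m _ t0.
  have := h0 m; have := kapS m t t0; case=> ke hm.
    rewrite ke F_double p_double subrr normr0 mulr_ge0 ?addr_ge0 //.
    by rewrite exprn_ge0 // ltW.
  rewrite ke in near1 *; rewrite /= F_double p_double.
  set a := p m _ in near0 *; set b := p _ _ in near1 *.
  have -> : F m (kap m t) + (E m.+1 (kap m t).*2 + W 0 a b) + W 0 b t
      - (F m (kap m t) + W 0 a t) = E m.+1 (kap m t).*2 + W a b t.
    by have := cW 0 a b t; lra.
  apply: le_trans (ler_normD _ _) _; rewrite mulrDl; apply: lerD.
    apply: le_trans (EM _ _) _; apply: ler_wpM2l => //.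
    by rewrite exprS ler_piMl ?exprn_ge0 // ltW.
  apply: WK; last by apply: le_trans near1 _; rewrite hS; lra.
  by rewrite /b p_S p_double hS -/a ler_norml; apply/andP; split; lra.
have q01' : 0 <= q < 1 by rewrite ltW.
have lim t : exists l, 0 <= t -> forall m, `|u t m - l| <= (M + K) / (1 - q) * q ^+ m.
  have [t0|t0] := leP 0 t; last by exists 0.
  by have [l lP] := geometric_limit q01' (fun m => uS t m t0); exists l.
pose f t := projT1 (cid (lim t)); set C := (M + K) / (1 - q).
have fu t m : 0 <= t -> `|u t m - f t| <= C * q ^+ m.
  by rewrite /f; case: cid => l /= lP /lP; apply.
(* [C + C] replaces [f] by [u] at both ends, [M + K + K] bounds the increment of [u], and [K + K]
   pays for exchanging [s] and [t]. *)
exists f, (C + C + (M + K + K) + (K + K)).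
have key m s t : 0 <= s -> s <= t -> `|t - s| <= 2^-1 ^+ m ->
    `|f t - f s - W 0 s t| <= (C + C + (M + K + K)) * q ^+ m.
  move=> s0 st ts; have t0 := le_trans s0 st.
  have Eg : `|u t m - u s m - W 0 s t| <= (M + K + K) * q ^+ m.
    have /andP[a b] := kapP m _ s0; rewrite /u.
    have nt := near m _ t0; have ns := near m _ s0.
    have qm : 0 <= q ^+ m by rewrite exprn_ge0 // ltW.
    (* As t - s is at most 2^-m, [t] lies in the dyadic interval of [s] or in the next one. *)
    have [c|c] := ltP t (p m (kap m s).+1).
      have -> : kap m t = kap m s by apply: kap_eq; rewrite // c (le_trans a st).
      have -> : F m (kap m s) + W 0 (p m (kap m s)) t -
         (F m (kap m s) + W 0 (p m (kap m s)) s) - W 0 s t = - W (p m (kap m s)) s t.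
        by have := cW 0 (p m (kap m s)) s t; lra.
      rewrite normrN; apply: le_trans (WK _ _ _ _ ns ts) _.
      by rewrite ler_wpM2r // lerDr addr_ge0.
    have ke : kap m t = (kap m s).+1.
      apply: kap_eq => //; rewrite c p_S.
      by move: ts; rewrite ler_norml => /andP[_ ?]; lra.
    rewrite ke in nt *; rewrite /= p_S in nt *.
    set A := p m (kap m s) in nt ns *; set B := A + _ in nt *.
    have -> : F m (kap m s) + (E m (kap m s) + W 0 A B) + W 0 B t -
        (F m (kap m s) + W 0 A s) - W 0 s t = E m (kap m s) + W A B t - W A s t.
      by have := cW 0 A B t; have := cW 0 A s t; lra.
    apply: le_trans (ler_normB _ _) _; rewrite 2!mulrDl; apply: lerD; last exact: WK.
    apply: le_trans (ler_normD _ _) _; apply: lerD; first exact: EM.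
    by apply: WK => //; rewrite /B addrC addKr ger0_norm // ltW.
  have := fu t m t0; have := fu s m s0.
  by move: Eg; rewrite !mulrDl !ler_norml => /andP[? ?] /andP[? ?] /andP[? ?]; lra.
move=> m s t s0 t0 ts; have [st|/ltW st] := leP s t.
  apply: le_trans (key _ _ _ s0 st ts) _; apply: ler_wpM2r.
    by rewrite exprn_ge0 // ltW.
  by rewrite lerDl addr_ge0.
(* To reverse the interval: [W 0 s t + W 0 t s = W s t s + W s s s] by two instances of the cocycle
   relation. *)
have ts' : `|s - t| <= 2^-1 ^+ m by rewrite distrC.
have := key _ _ _ t0 st ts'.
have ss : `|s - s| <= 2^-1 ^+ m by rewrite subrr normr0 ltW.
have := WK _ _ _ _ ts ts'; have := WK _ _ _ _ ss ss.
have := cW 0 s t s; have := cW 0 s s s.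
rewrite !mulrDl !ler_norml => ? ? /andP[? ?] /andP[? ?] /andP[? ?]; lra.
Qed.

End Geometric.

(** * Sewing of Hoelder cocycles on the unit interval *)

Section HolderSewing.
Variable R : realType.
Local Notation I := (unit_interval R).

Lemma clamp_subproof (r : R) : Num.max 0 (Num.min 1 r) \in `[0, 1].
Proof.
by rewrite in_itv /= le_max lexx /= ge_max ler01 ge_min lexx.
Qed.

(** This 1-Lipschitz retraction extends a cocycle from the unit interval to the real line, since the
    dyadic points around [t] may exceed 1. *)
Definition clamp (r : R) : I := exist _ (Num.max 0 (Num.min 1 r)) (clamp_subproof r).

Lemma val_clamp (r : R) : 0 <= r <= 1 -> val (clamp r) = r.
Proof. by move=> /andP[r0 r1]; rewrite /= (min_r r1) (max_r r0). Qed.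

Lemma clampK (s : I) : clamp (val s) = s.
Proof. by apply/val_inj/val_clamp; have := valP s; rewrite in_itv. Qed.

Lemma clamp_lipschitz (r r' : R) : `|val (clamp r') - val (clamp r)| <= `|r' - r|.
Proof.
rewrite /=.
have minP (x : R) : Num.min 1 x = if 1 < x then 1 else x by [].
have maxP (x : R) : Num.max 0 x = if 0 < x then x else 0 by [].
rewrite !maxP !minP; case: (ltP 1 r) => ?; case: (ltP 1 r') => ?; rewrite ?ltr01;
  try case: (ltP 0 r) => ?; try case: (ltP 0 r') => ?; rewrite ler_norml;
  by case: (ger0P (r' - r)) => ?; apply/andP; split; lra.
Qed.

Lemma half_powR_lt1 (a : R) : 0 < a -> 0 < (2^-1 : R) `^ a < 1.
Proof.
move=> a0; have h0 : 0 < (2^-1 : R) by rewrite invr_gt0.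
have one : (1 : R) `^ a = 1 by rewrite powR1.
rewrite powR_gt0 //= -[X in _ < X]one gt0_ltr_powR ?nnegrE ?ler01 ?(ltW h0) //.
by rewrite invf_lt1 // ltr1n.
Qed.

Lemma half_powR_expn (a : R) m : (2^-1 : R) `^ a ^+ m = (2^-1 ^+ m) `^ a.
Proof.
elim: m => [|m IH]; first by rewrite !expr0 powR1.
by rewrite !exprS IH powRM ?exprn_ge0 // invr_ge0.
Qed.

Lemma double_half_powR_neq1 (a : R) : a != 1 -> 2 * (2^-1 : R) `^ a != 1.
Proof.
move=> a1; apply/eqP => e; have h0 : 0 < (2^-1 : R) by rewrite invr_gt0.
have h1 : (2^-1 : R) < 1 by rewrite invf_lt1 // ltr1n.
have : (2^-1 : R) `^ a = 2^-1 by apply: (@mulfI _ 2); rewrite ?pnatr_eq0 // e divff ?pnatr_eq0.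
move=> /(congr1 (@ln R)); rewrite ln_powR -[X in _ = X]mul1r => /mulIf e1.
by move/negP: a1; apply; apply/eqP/e1; rewrite lt_eqF // ln_lt0 // h0.
Qed.

Lemma dyadic_scale (h : R) : 0 < h <= 1 -> exists m, 2^-1 ^+ m.+1 < h <= 2^-1 ^+ m.
Proof.
move=> /andP[h0 h1].
have ex : exists m, 2^-1 ^+ m < h.
  apply: contrapT => /forallNP no.
  have h_eq0 : h = 0; last by move: h0; rewrite h_eq0 ltxx.
  apply: (@geometric_vanish _ h 1 2^-1) => [|j].
    by rewrite invr_ge0 ler0n invf_lt1 // ltr1n.
  by rewrite mul1r (ger0_norm (ltW h0)) leNgt; apply/negP.
case: (ex_minnP ex) => -[|m]; first by rewrite expr0 ltNge h1.
move=> mh min; exists m; rewrite mh leNgt; apply/negP => /min.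
by rewrite ltnn.
Qed.

(** By the cocycle relation, [- W 0 s t] already solves the equation, but without the Hoelder order.
    Adding the increment of the dyadic integral [f] keeps the equation and provides the order. *)
Lemma holder_sewing (W : I -> I -> I -> R) (a K : R) : 0 < a -> a != 1 ->
  (forall s u t v, W s u t + W s t v = W u t v + W s u v) ->
  (forall l s u t, `|val u - val s| <= l -> `|val t - val u| <= l ->
     `|W s u t| <= K * l `^ a) ->
  exists e : I -> I -> R,
    (forall s u t, e s t = e s u + e u t + W s u t) /\
    exists C, forall s t, `|e s t| <= C * `|val t - val s| `^ a.
Proof.
move=> a0 a1 cW WK; set q := (2^-1 : R) `^ a.
have q01 := half_powR_lt1 a0; have /andP[q0 q1] := q01.
have [||f [C fC]] := @dyadic_integral R
    (fun s u t => W (clamp s) (clamp u) (clamp t)) K q q01 (double_half_powR_neq1 a1).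
- by move=> s u t v; apply: cW.
- move=> m s u t us tu; rewrite half_powR_expn; apply: WK.
    by apply: le_trans us; apply: clamp_lipschitz.
  by apply: le_trans tu; apply: clamp_lipschitz.
have I0 (s : I) : 0 <= val s by have := valP s; rewrite in_itv => /andP[].
have I1 (s : I) : val s <= 1 by have := valP s; rewrite in_itv => /andP[].
pose e (s t : I) := f (val t) - f (val s) - W (clamp 0) s t.
have eC m s t : `|val t - val s| <= 2^-1 ^+ m -> `|e s t| <= C * q ^+ m.
  by move=> st; have := fC m _ _ (I0 s) (I0 t) st; rewrite !clampK.
have C0 : 0 <= C.
  have := eC 0%N (clamp 0) (clamp 0); rewrite subrr normr0 mulr1 => /(_ ler01).
  exact: le_trans.
exists e; split.
  by move=> s u t; rewrite /e; have := cW (clamp 0) s u t; lra.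
(* The dyadic scale [m] of [h] satisfies 2^-(m+1) < h, so that q^(m+1) is at most h^a: one factor
   [q] is lost. *)
exists (C / q) => s t; set h := `|val t - val s|.
(* No dyadic scale fits [h = 0]; there the bounds at all levels force [e s t = 0]. *)
have [h0|h0] := eqVneq h 0.
  have -> : e s t = 0.
    apply: (@geometric_vanish _ _ C q) => [|m]; first by rewrite q1 ltW.
    by apply: eC; rewrite -/h h0 exprn_ge0 // invr_ge0.
  by rewrite normr0 mulr_ge0 ?powR_ge0 // divr_ge0 // ltW.
have {}h0 : 0 < h by rewrite lt0r h0 normr_ge0.
have h1 : h <= 1.
  rewrite /h ler_norml; have := I0 s; have := I0 t; have := I1 s; have := I1 t.
  by move=> *; apply/andP; split; lra.
have [m /andP[mh hm]] : exists m, 2^-1 ^+ m.+1 < h <= 2^-1 ^+ m.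
  by apply: dyadic_scale; rewrite h0.
apply: le_trans (eC m _ _ hm) _; rewrite -mulrA; apply: ler_wpM2l => //.
rewrite ler_pdivlMl // -exprS half_powR_expn ge0_ler_powR ?nnegrE ?(ltW a0) ?(ltW h0) ?(ltW mh) //.
by rewrite exprn_ge0 // invr_ge0.
Qed.

(** Each bisection of the interval at its midpoint improves the constant by the factor 2^(1 - a) <
    1. *)
Lemma holder_additive_eq0 (r : I -> I -> R) (a C : R) : 1 < a ->
  (forall s u t, r s t = r s u + r u t) ->
  (forall s t, `|r s t| <= C * `|val t - val s| `^ a) ->
  forall s t, r s t = 0.
Proof.
move=> a1 rD rC s t; set q := 2 * (2^-1 : R) `^ a.
have h0 : 0 < (2^-1 : R) by rewrite invr_gt0.
have q01 : 0 <= q < 1.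
  rewrite mulr_ge0 ?powR_ge0 //=.
  rewrite -[q](@mulfK _ (2^-1 : R)) ?gt_eqF // -/q ltr_pdivrMr // mul1r mulrAC.
  rewrite divff ?pnatr_eq0 // mul1r.
  have -> : a = 1 + (a - 1) by ring.
  rewrite powRD; last by apply/implyP => _; rewrite gt_eqF.
  rewrite powRr1 ?ltW // gtr_pMr //.
  by have /half_powR_lt1/andP[] : 0 < a - 1; rewrite ?subr_gt0.
have bound n : forall s t, `|r s t| <= C * q ^+ n * `|val t - val s| `^ a.
  elim: n => [|n IH] x y; first by rewrite expr0 mulr1.
  pose z := clamp ((val x + val y) / 2).
  have zE : val z = (val x + val y) / 2.
    apply: val_clamp; have := valP x; have := valP y; rewrite !in_itv /=.
    by move=> /andP[? ?] /andP[? ?]; apply/andP; split; lra.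
  have hx : `|val z - val x| = 2^-1 * `|val y - val x|.
    have -> : val z - val x = 2^-1 * (val y - val x) by rewrite zE; field.
    by rewrite normrM ger0_norm // ltW.
  have hy : `|val y - val z| = 2^-1 * `|val y - val x|.
    have -> : val y - val z = 2^-1 * (val y - val x) by rewrite zE; field.
    by rewrite normrM ger0_norm // ltW.
  rewrite (rD x z y); apply: le_trans (ler_normD _ _) _.
  apply: le_trans (lerD (IH _ _) (IH _ _)) _.
  rewrite hx hy powRM ?(ltW h0) // exprS /q le_eqVlt; apply/orP; left; apply/eqP.
  ring.
apply: (@geometric_vanish _ _ (C * `|val t - val s| `^ a) q) => // n.
by rewrite mulrAC; apply: bound.
Qed.

End HolderSewing.

(** * Associativity of the convolution product *)

Lemma malg_linear_ind (R : comNzRingType) (K : choiceType) (P : {malg R[K]} -> Prop) :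
    (forall a x y, P x -> P y -> P (a *: x + y)) -> P 0 -> (forall k, P (basis k)) ->
  forall x, P x.
Proof.
move=> Plin P0 Pbasis x.
rewrite [x]monalgE; elim/big_rec: _ => // k y _ Py.
by rewrite malgZU; apply: Plin.
Qed.

Section ForestEval.
Variables (R : comNzRingType) (d : nat).
Implicit Types (f : forest d) (v : tree d -> R).

Definition forest_eval v f : R := \prod_(t <- finsupp f) v t ^+ f t.

Lemma forest_evalEw v (D : {fset tree d}) f : (finsupp f `<=` D)%fset ->
  forest_eval v f = \prod_(t <- D) v t ^+ f t.
Proof.
by move=> sD; apply: big_fset_incl => // t _ tNf; case: finsuppP tNf => // _ _.
Qed.

Lemma forest_eval1 v : forest_eval v mone = 1.
Proof. by rewrite /forest_eval mdom1 big_seq_fset0. Qed.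

Lemma forest_evalM v f1 f2 :
  forest_eval v (mmul f1 f2) = forest_eval v f1 * forest_eval v f2.
Proof.
set D := (finsupp f1 `|` finsupp f2)%fset.
rewrite !(@forest_evalEw v D) ?fsubsetUl ?fsubsetUr ?mdomD //.
by rewrite -big_split; apply: eq_bigr => t _; rewrite cmM exprD.
Qed.

Lemma forest_evalU v t : forest_eval v (tree1 t) = v t.
Proof. by rewrite /forest_eval mdomU big_seq_fset1 cmUU expr1. Qed.

Lemma eq_forest_eval v1 v2 f : (forall t, t \in finsupp f -> v1 t = v2 t) ->
  forest_eval v1 f = forest_eval v2 f.
Proof. by move=> v12; apply: eq_big_seq => t /v12 ->. Qed.

End ForestEval.

Section CharacterOfTrees.
Variables (R : realType) (d : nat).
Implicit Types (v : tree d -> R).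

Definition tree_char_fun v (x : bck R d) : R :=
  (linext (fun f => forest_eval v f : R^o) x : R^o).

Lemma tree_char_fun_is_linear v : linear_for *%R (tree_char_fun v).
Proof. by move=> a x y; rewrite /tree_char_fun linearP. Qed.

HB.instance Definition _ v :=
  GRing.isLinear.Build R (bck R d) R *%R (tree_char_fun v) (tree_char_fun_is_linear v).

Lemma tree_char_funU v f : tree_char_fun v (basis f) = forest_eval v f.
Proof. by rewrite /tree_char_fun linextU. Qed.

Lemma tree_char_neq0 v : exists x, tree_char_fun v x != 0.
Proof. by exists (basis mone); rewrite tree_char_funU forest_eval1 oner_neq0. Qed.

Lemma tree_char_mul v : {morph tree_char_fun v : x y / x * y}.
Proof.
apply: (@malg_mulP R (forest d) R^o (linext (fun f => forest_eval v f : R^o))).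
by move=> x y; rewrite /= !linextU forest_evalM.
Qed.

(** Forests form the free commutative monoid on trees, so arbitrary values on trees extend to a
    character; with [tree_charK], characters become functions on trees. *)
Definition tree_char v : character R d :=
  @Character R d (tree_char_fun v) (tree_char_neq0 v) (@tree_char_mul v).

Lemma tree_charU v f : tree_char v (basis f) = forest_eval v f.
Proof. exact: tree_char_funU. Qed.

Lemma tree_charE v t : tree_char v (basis (tree1 t)) = v t.
Proof. by rewrite tree_charU forest_evalU. Qed.

Lemma character_basis (X : character R d) f :
  X (basis f) = forest_eval (fun t => X (basis (tree1 t))) f.
Proof.
rewrite -[f]seq_of_forestK /forest_of; elim: (seq_of_forest f) => [|t s IH].
  by rewrite big_nil basis1 character1 forest_eval1.
by rewrite big_cons basisM characterM IH forest_evalM forest_evalU.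
Qed.

Lemma character_trees_ext (X Y : character R d) :
  (forall t, X (basis (tree1 t)) = Y (basis (tree1 t))) -> X = Y.
Proof.
move=> XY; apply: character_ext => x.
elim/malg_linear_ind: x => [a x y|| f]; first by rewrite !linearP => -> ->.
  by rewrite !linear0.
by rewrite !character_basis; apply: eq_forest_eval => t _; apply: XY.
Qed.

Lemma tree_charK (X : character R d) : tree_char (fun t => X (basis (tree1 t))) = X.
Proof. by apply: character_trees_ext => t; rewrite tree_charE. Qed.

End CharacterOfTrees.

Section Convolution.
Variables (R : realType) (d : nat).
Implicit Types (X Y Z : character R d).

Definition graft_lin (i : 'I_d) : bck R d -> bck R d :=
  linext (fun f => basis (tree1 (graft i f))).

HB.instance Definition _ i := GRing.Linear.on (graft_lin i).

(* X (x) id *)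
Definition eval_left X : bck2 R d -> bck R d :=
  linext (fun m => X (basis m.1) *: basis m.2).

HB.instance Definition _ X := GRing.Linear.on (eval_left X).

Lemma eval_leftU X m : eval_left X (basis m) = X (basis m.1) *: basis m.2.
Proof. by rewrite /eval_left linextU. Qed.

Lemma eval_leftM X : {morph eval_left X : x y / x * y}.
Proof.
apply: malg_mulP => x y; rewrite /= !eval_leftU /= !basisM characterM.
by rewrite -scalerAl -scalerAr scalerA.
Qed.

(** The algebra endomorphism (X (x) id) Delta. Since [star X Y] is [Y] composed with it,
    associativity becomes a statement about endomorphisms and no triple tensor product is formed. *)
Definition translate X (x : bck R d) : bck R d := eval_left X (coproduct x).

Lemma translate_is_linear X : linear (translate X).
Proof. by move=> a x y; rewrite /translate !linearP. Qed.

HB.instance Definition _ X :=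
  GRing.isLinear.Build R (bck R d) (bck R d) *:%R (translate X) (translate_is_linear X).

Lemma translateM X : {morph translate X : x y / x * y}.
Proof. by move=> x y; rewrite /translate rmorphM eval_leftM. Qed.

Lemma translate1 X : translate X 1 = 1.
Proof.
by rewrite /translate rmorph1 -basis1 eval_leftU /= !basis1 character1 scale1r.
Qed.

Lemma translate_one X : translate X (basis mone) = basis mone.
Proof. by rewrite basis1 translate1. Qed.

Lemma character_one X : X (basis mone) = 1.
Proof. by rewrite basis1 character1. Qed.

Lemma eval_left_graft X i (m : bck2 R d) :
  eval_left X (graft_right i m) = graft_lin i (eval_left X m).
Proof.
have /= := @malg_lin_ext R _ _ (eval_left X \o graft_right i) (graft_lin i \o eval_left X).
apply=> k /=.
by rewrite [graft_right i _]linextU !eval_leftU /= linearZ /= [graft_lin i _]linextU.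
Qed.

Let scale_add_comb (V : lmodType R) (a p q : R) (o u v : V) :
  a *: (p *: o + u) + (q *: o + v) = (a * p + q) *: o + (a *: u + v).
Proof. by rewrite scalerDr scalerDl -scalerA addrACA. Qed.

Let scale_addA (V : lmodType R) (p q : R) (o v : V) :
  (p + q) *: o + v = p *: o + (q *: o + v).
Proof. by rewrite scalerDl addrA. Qed.

Lemma translate_affine X p x :
  translate X (p *: basis mone + x) = p *: basis mone + translate X x.
Proof.
rewrite (linearP (translate X) p (basis mone) x).
exact: (congr1 (fun u => p *: u + translate X x) (translate_one X)).
Qed.

Lemma character_affine X p x : X (p *: basis mone + x) = p + X x.
Proof. by rewrite (linearP X p (basis mone) x) /= character_one mulr1. Qed.

Lemma translate_graft X i (x : bck R d) :
  translate X (graft_lin i x) = X (graft_lin i x) *: basis mone + graft_lin i (translate X x).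
Proof.
elim/malg_linear_ind: x => [a x y|| f].
- move=> IHx IHy; rewrite (linearP (graft_lin i) a x y).
  rewrite (linearP (translate X) a (graft_lin i x) (graft_lin i y)).
  rewrite (linearP (translate X) a x y) (linearP (graft_lin i) a (translate X x)).
  rewrite (linearP X a (graft_lin i x) (graft_lin i y)).
  refine (etrans (congr2 (fun u v => a *: u + v) IHx IHy) _).
  exact: scale_add_comb.
- by rewrite !linear0 scale0r addr0.
rewrite [graft_lin i (basis f)]linextU {1}/translate coproduct_graft linearD /=.
by rewrite eval_leftU eval_left_graft.
Qed.

Lemma star_translate X Y x : star X Y x = Y (translate X x).
Proof.
have tensorE m : tensor X Y m = Y (eval_left X m).
  elim/malg_linear_ind: m => [a m n IHm IHn|| m].
  - rewrite (linearP (eval_left X) a m n) (linearP (tensor X Y) a m n).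
    rewrite (linearP Y a (eval_left X m) (eval_left X n)).
    exact: (congr2 (fun u v => a * u + v) IHm IHn).
  - by rewrite !linear0.
  - by rewrite /tensor linextU eval_leftU linearZ.
exact: tensorE.
Qed.

(** Both sides are multiplicative, which reduces the claim to trees. On a grafted tree both unfold
    by [translate_graft], and their scalar terms agree by [star_translate]. *)
Lemma translate_star X Y x : translate (star X Y) x = translate Y (translate X x).
Proof.
pose P f := translate (star X Y) (basis f) = translate Y (translate X (basis f)).
have ext (s : seq (tree d)) : (forall t, t \in s -> P (tree1 t)) -> P (forest_of s).
  rewrite /forest_of; elim: s => [|t s IH] Hs.
    by rewrite /P big_nil basis1 !translate1.
  have Ht : P (tree1 t) by apply: Hs; rewrite mem_head.
  have {}IH : P (\big[mmul/mone]_(u <- s) tree1 u).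
    by apply: IH => u us; apply: Hs; rewrite inE us orbT.
  rewrite /P big_cons basisM translateM translateM translateM.
  exact: (congr2 *%R Ht IH).
have tP t : P (tree1 t).
  elim/tree_graft_ind: t => i s /ext; rewrite /P => IH.
  have <- : graft_lin i (basis (forest_of s)) =
    basis (tree1 (graft i (forest_of s))) :> bck R d by exact: linextU.
  set y := basis _ in IH *.
  rewrite [RHS](congr1 (translate Y) (translate_graft X i y)) translate_graft IH.
  rewrite [RHS]translate_affine star_translate translate_graft character_affine.
  rewrite [in RHS]translate_graft; apply: scale_addA.
elim/malg_linear_ind: x => [a x y IHx IHy|| f].
- refine (etrans (linearP (translate (star X Y)) a x y) _).
  refine (etrans _ (esym (congr1 (translate Y) (linearP (translate X) a x y)))).
  refine (etrans _ (esym (linearP (translate Y) a (translate X x) (translate X y)))).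
  exact: (congr2 (fun u v => a *: u + v) IHx IHy).
- by rewrite !linear0.
- by rewrite -[f]seq_of_forestK; apply: ext.
Qed.

Lemma starA X Y Z : star (star X Y) Z = star X (star Y Z).
Proof.
by apply: character_ext => x; rewrite !star_translate translate_star.
Qed.

End Convolution.

(** * Embeddings of decorated trees *)

Section Addresses.
Local Open Scope nat_scope.
Variable d : nat.
Implicit Types (p q : ptree d) (s : seq (ptree d)) (a b : seq nat).

(** The addresses below the root, with children numbered from [m] so that induction on their list
    goes through. *)
Let flat m (ss : seq (seq (seq nat))) : seq (seq nat) :=
  flatten [seq map (cons kp.1) kp.2 | kp <- zip (iota m (size ss)) ss].

Let mem_flat m ss a : (a \in flat m ss) =
  if a is k :: b then [&& m <= k, k - m < size ss & b \in nth [::] ss (k - m)]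
  else false.
Proof.
elim: ss m a => [|x ss IH] m a; first by case: a => // k b; rewrite ltn0 andbF.
rewrite [flat _ _]/(_ ++ flat m.+1 ss) mem_cat IH; case: a => [|k b].
  by rewrite orbF; apply/negbTE/negP => /mapP[].
have -> : (k :: b \in map (cons m) x) = (k == m) && (b \in x).
  apply/mapP/andP => [[b' b'x [-> ->]]|[/eqP-> bx]]; first by rewrite eqxx.
  by exists b.
have [mk|km|->] := ltngtP m k; rewrite ?subnn ?ltnn ?orbF //=.
by rewrite subnS; case: (k - m) (subn_gt0 m k) => [|j] /=; rewrite mk.
Qed.

Let addressesE i s : addresses (Node i s) = [::] :: flat 0 (map (@addresses d) s).
Proof. by rewrite /flat size_map. Qed.

Lemma root_in_addresses p : [::] \in addresses p.
Proof. by case: p => i s; rewrite addressesE mem_head. Qed.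

Lemma in_addresses_cons p0 i s k a : (k :: a \in addresses (Node i s)) =
  (k < size s) && (a \in addresses (nth p0 s k)).
Proof.
rewrite addressesE inE /= mem_flat leq0n subn0 size_map /=.
by case: ltnP => // ks; rewrite (nth_map p0).
Qed.

Lemma ptree_at_cons p0 i s k a : k < size s ->
  ptree_at (Node i s) (k :: a) = ptree_at (nth p0 s k) a.
Proof. by move=> ks /=; rewrite (set_nth_default p0). Qed.

Lemma uniq_addresses p : uniq (addresses p).
Proof.
elim/ptree_all_ind: p => i s IH; rewrite addressesE /= mem_flat /=.
have : all uniq (map (@addresses d) s).
  by elim: s IH => //= p s IHs [-> /IHs ->].
elim: (map _ s) 0 => //= x ss IHss m /andP[ux /IHss uss].
rewrite [flat _ _]/(_ ++ flat m.+1 ss) cat_uniq uss andbT map_inj_uniq ?ux /=.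
  apply/hasPn => a; rewrite mem_flat; case: a => // k b /and3P[mk _ _].
  by apply/negP => /mapP[c _ [km _]]; rewrite km ltnn in mk.
by move=> ? ? [].
Qed.

Lemma size_addresses i s :
  size (addresses (Node i s)) = (\sum_(p <- s) size (addresses p)).+1.
Proof.
rewrite addressesE /=; congr S.
suff: forall m, size (flat m (map (@addresses d) s)) = \sum_(p <- s) size (addresses p) by [].
elim: s => [|p s IH] m; first by rewrite big_nil.
by rewrite [flat _ _]/(_ ++ flat m.+1 _) size_cat size_map IH big_cons.
Qed.

Lemma take_addresses p a n : a \in addresses p -> take n a \in addresses p.
Proof.
elim: a p n => [|k a IH] [i s] [|n] //; rewrite ?root_in_addresses //.
by rewrite !(in_addresses_cons (Node i s)) => /andP[-> /IH ->].
Qed.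

End Addresses.

Section PtreeEmbedding.
Local Open Scope nat_scope.
Variable d : nat.
Implicit Types (p q : ptree d) (s : seq (ptree d)) (a b : seq nat).

(* [e] maps the addresses of [p] to those of a copy of [p] in [q] whose root has
   depth [c] *)
Definition embedding_at c p q (e : seq nat -> seq nat) : Prop :=
  [/\ {in addresses p, forall a, e a \in addresses q},
      {in addresses p, forall a, size (e a) = size a + c},
      {in addresses p &, forall a b, prefix (e a) (e b) = prefix a b}
    & {in addresses p, forall a,
        root_label (ptree_at q (e a)) = root_label (ptree_at p a)}].

Definition embeds_at c p q : Prop := exists e, embedding_at c p q e.

Lemma embeds_at_refl p : embeds_at 0 p p.
Proof. by exists id; split=> // a _; rewrite addn0. Qed.

Lemma embeds_at_trans c c' p q r :
  embeds_at c p q -> embeds_at c' q r -> embeds_at (c + c') p r.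
Proof.
move=> [e [e1 e2 e3 e4]] [e' [e1' e2' e3' e4']]; exists (e' \o e); split=> /=.
- by move=> a /e1/e1'.
- by move=> a ap; rewrite e2' ?e1 // e2 // addnA.
- by move=> a b ap bp; rewrite e3' ?e1 // e3.
- by move=> a ap; rewrite e4' ?e1 // e4.
Qed.

Lemma embeds_at_child i s q : q \in s -> embeds_at 1 q (Node i s).
Proof.
move=> qs; exists (cons (index q s)); have ks : index q s < size s by rewrite index_mem.
split=> [a aq|a aq|a b aq bq|a aq].
- by rewrite (in_addresses_cons q) ks nth_index.
- by rewrite addn1.
- by rewrite prefix_cons eqxx.
- by rewrite (ptree_at_cons q) // nth_index.
Qed.

Definition embeds_seq (p0 : ptree d) s1 s2 : Prop := exists pi : nat -> nat,
  {in gtn (size s1) &, injective pi} /\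
  forall k, k < size s1 -> pi k < size s2 /\ embeds_at 0 (nth p0 s1 k) (nth p0 s2 (pi k)).

Lemma embeds_seq_nil p0 s : embeds_seq p0 [::] s.
Proof. by exists id; split. Qed.

Lemma embeds_seq_skip p0 s1 q s2 : embeds_seq p0 s1 s2 -> embeds_seq p0 s1 (q :: s2).
Proof.
move=> [pi [pi_inj piP]]; exists (S \o pi); split=> [k l k1 l1 [/pi_inj]|k k1]; first exact.
by have [] := piP k k1.
Qed.

Lemma embeds_seq_cons p0 p s1 q s2 : embeds_at 0 p q ->
  embeds_seq p0 s1 s2 -> embeds_seq p0 (p :: s1) (q :: s2).
Proof.
move=> pq [pi [pi_inj piP]]; exists (fun k => if k is k'.+1 then (pi k').+1 else 0).
split=> [|[|k] //= k1]; last exact: piP.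
by move=> [|k] [|l] //= k1 l1 [/pi_inj->].
Qed.

Lemma embeds_seq_perm p0 s1 s1' s2 s2' : perm_eq s1' s1 -> perm_eq s2 s2' ->
  embeds_seq p0 s1 s2 -> embeds_seq p0 s1' s2'.
Proof.
move=> /(perm_iotaP p0) [I1 I1p s1E] /(perm_iotaP p0) [I2 I2p s2E] [pi [pi_inj piP]].
have sI1 : size I1 = size s1 by rewrite (perm_size I1p) size_iota.
have sI2 : size I2 = size s2' by rewrite (perm_size I2p) size_iota.
have uI1 : uniq I1 by rewrite (perm_uniq I1p) iota_uniq.
have uI2 : uniq I2 by rewrite (perm_uniq I2p) iota_uniq.
have I1lt k : k < size I1 -> nth 0 I1 k < size s1.
  by move=> /(mem_nth 0); rewrite (perm_mem I1p) mem_iota add0n.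
have sz1 : size s1' = size I1 by rewrite s1E size_map.
have sz2 : size s2 = size I2 by rewrite s2E size_map.
exists (fun k => nth 0 I2 (pi (nth 0 I1 k))); split.
  move=> k l; rewrite !inE sz1 => k1 l1 /eqP.
  have [pk _] := piP _ (I1lt _ k1); have [pl _] := piP _ (I1lt _ l1).
  rewrite nth_uniq -?sz2 // => /eqP /pi_inj; rewrite !inE => /(_ (I1lt _ k1) (I1lt _ l1)).
  by move/eqP; rewrite nth_uniq // => /eqP.
move=> k; rewrite sz1 => k1; have [pk pe] := piP _ (I1lt _ k1); split.
  have := mem_nth 0 (_ : pi (nth 0 I1 k) < size I2).
  by rewrite -sz2 => /(_ pk); rewrite (perm_mem I2p) mem_iota add0n.
have E j : j < size s2 -> nth p0 s2 j = nth p0 s2' (nth 0 I2 j).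
  by rewrite sz2 => j2; rewrite s2E (nth_map 0).
by move: pe; rewrite E // s1E (nth_map 0).
Qed.

Lemma embeds_at_node p0 i s1 s2 : embeds_seq p0 s1 s2 ->
  embeds_at 0 (Node i s1) (Node i s2).
Proof.
move=> [pi [pi_inj piP]].
have /choice [e eP] : forall k, exists e, k < size s1 ->
    embedding_at 0 (nth p0 s1 k) (nth p0 s2 (pi k)) e.
  move=> k; have [k1|k1] := ltnP k (size s1); last by exists id.
  by have [_ [e ?]] := piP k k1; exists e.
exists (fun a => if a is k :: b then pi k :: e k b else [::]); split.
- move=> [|k a]; first by rewrite !root_in_addresses.
  rewrite !(in_addresses_cons p0) => /andP[k1 ak].
  by have [-> _] := piP k k1; have [eA _ _ _] := eP k k1; apply: eA.
- move=> [|k a] //; rewrite (in_addresses_cons p0) => /andP[k1 ak] /=.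
  by have [_ -> //] := eP k k1.
- move=> [|k a] [|l b] //; rewrite !(in_addresses_cons p0) => /andP[k1 ak] /andP[l1 bl].
  rewrite !prefix_cons; have [kl|] := eqVneq k l.
    by rewrite -kl eqxx in bl *; have [_ _ -> //] := eP k k1.
  by move=> kl; rewrite (negbTE (contra_neq _ kl)) //; apply: pi_inj.
- move=> [|k a] //; rewrite (in_addresses_cons p0) => /andP[k1 ak].
  have [pk _] := piP k k1; rewrite !(ptree_at_cons p0) //.
  by have [_ _ _ eL] := eP k k1; apply: eL.
Qed.

End PtreeEmbedding.

(** * From embeddings to containment *)

Section Containment.
Local Open Scope nat_scope.
Variable d : nat.
Implicit Types (rho sigma tau t : tree d).

(** A composable counterpart of [contains]; the constant depth shift [c] is the depth of the root of
    the copy. *)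
Definition embeds tau sigma : Prop := exists c, embeds_at c (val tau) (val sigma).

(** The node set is pushed forward along the address map: preserving prefixes and shifting all
    depths equally preserves parenthood, hence adjacency, connectedness and the lowest node. *)
Lemma contains_embeds rho sigma tau :
  contains rho tau -> embeds rho sigma -> contains sigma tau.
Proof.
move=> [S [[S0 Sconn] [phi [phi_inj phiS phi_adj phi_lab phi_root]]]].
move=> [c [e [eA eS eP eL]]].
pose f (v : node rho) : node sigma := SeqSub (eA _ (valP v)).
have f_depth v : depth (f v) = depth v + c by rewrite /depth /= eS ?(valP v).
have f_child u v : is_child (f u) (f v) = is_child u v.
  by rewrite /is_child !f_depth -addSn eqn_add2r /= eP ?(valP u) ?(valP v).
have f_adj u v : adjacent (f u) (f v) = adjacent u v by rewrite /adjacent !f_child.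
have f_inj : injective f.
  move=> u v uv; apply: val_inj.
  have uv' : e (val u) = e (val v) by have /= := congr1 val uv.
  have pre (x y : node rho) : e (val x) = e (val y) -> prefix (val x) (val y).
    move=> xy; have <- := eP _ _ (valP x) (valP y).
    by rewrite [X in prefix X _]xy prefix_refl.
  apply/eqP; have := pre _ _ uv'; have := pre _ _ (esym uv').
  rewrite !prefixE => /eqP vu _; apply/eqP; rewrite -vu.
  have : size (val u) = size (val v).
    by have := eS _ (valP u); rewrite [e _]uv' eS ?(valP v) // => /addIn.
  by move=> <-; rewrite take_size.
exists (f @: S); split; first split.
- by have /set0Pn[x xS] := S0; apply/set0Pn; exists (f x); apply: imset_f.
- move=> _ _ /imsetP[u uS ->] /imsetP[v vS ->].
  have /connectP[p] := Sconn u v uS vS.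
  elim: p u uS => [|w p IH] u uS /=; first by move=> _ ->; apply: connect0.
  move=> /andP[/and3P[_ wS uw] wp] vp.
  apply: connect_trans (IH w wS wp vp); apply: connect1 => /=.
  by rewrite !imset_f // f_adj.
- exists (f \o phi); split=> /=.
  + exact: inj_comp.
  + by rewrite imset_comp phiS.
  + by move=> u v; rewrite f_adj phi_adj.
  + by move=> u; rewrite -phi_lab /node_label /= eL ?(valP (phi u)).
  + move=> r r0 _ /imsetP[v vS ->]; rewrite !f_depth leq_add2r; exact: phi_root.
Qed.

Lemma contains_refl sigma : contains sigma sigma.
Proof.
pose root : node sigma := SeqSub (root_in_addresses (val sigma)).
exists [set: node sigma]; split; last first.
  exists id; split=> //; first by rewrite imset_id.
  by move=> r r0 v _; rewrite r0.
split; first by apply/set0Pn; exists root.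
set e := [rel _ _ | _]; have e_sym : symmetric e.
  by move=> x y; rewrite /e /= !inE /adjacent orbC.
(* Deleting the last entry of an address leads to the parent. *)
have to_root u : connect e u root.
  elim: {u}(depth u) {-2}u (erefl (depth u)) => [|n IH] u un.
    suff -> : u = root by apply: connect0.
    by apply: val_inj; apply/eqP; rewrite -size_eq0; apply/eqP.
  have [w ub] : exists w, w = val u by exists (val u).
  move: un; rewrite /depth; case/lastP: w ub => [|b k] ub; rewrite -ub // => un.
  have bA : b \in addresses (val sigma).
    have := take_addresses (size b) (valP u).
    by rewrite -ub -cats1 take_size_cat.
  have bn : depth (SeqSub bA : node sigma) = n.
    by move: un; rewrite size_rcons => -[].
  apply: connect_trans (IH _ bn); apply: connect1 => /=.
  rewrite !inE /adjacent /is_child bn [depth u](_ : _ = n.+1) ?eqxx ?andbT; last first.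
    by rewrite /depth -ub.
  by apply/orP; right; rewrite -ub -cats1 prefix_prefix.
move=> u v _ _; apply: connect_trans (to_root u) _.
by rewrite (sym_connect_sym e_sym); apply: to_root.
Qed.

Lemma contains_size rho tau : contains rho tau -> tree_size tau <= tree_size rho.
Proof.
move=> [S [_ [phi [phi_inj _ _ _ _]]]].
have card_node t : #|{: node t}| = tree_size t.
  by rewrite card_seq_sub ?uniq_addresses.
by rewrite -!card_node; apply: leq_card phi_inj.
Qed.

End Containment.

Section ForestSize.
Local Open Scope nat_scope.
Variable d : nat.
Implicit Types (t : tree d) (f : forest d) (s : seq (tree d)).

Lemma forest_sizeEw (D : {fset tree d}) f : (finsupp f `<=` D)%fset ->
  forest_size f = \sum_(t <- D) f t * tree_size t.
Proof.
by move=> sD; apply: big_fset_incl => // t _ tNf; case: finsuppP tNf => // _ _.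
Qed.

Lemma forest_size1 : forest_size (mone : forest d) = 0.
Proof. by rewrite /forest_size mdom1 big_seq_fset0. Qed.

Lemma forest_sizeM f1 f2 : forest_size (mmul f1 f2) = forest_size f1 + forest_size f2.
Proof.
set D := (finsupp f1 `|` finsupp f2)%fset.
rewrite !(@forest_sizeEw D) ?fsubsetUl ?fsubsetUr ?mdomD //.
by rewrite -big_split; apply: eq_bigr => t _; rewrite cmM mulnDl.
Qed.

Lemma forest_sizeU t : forest_size (tree1 t) = tree_size t.
Proof. by rewrite /forest_size mdomU big_seq_fset1 cmUU mul1n. Qed.

Lemma forest_size_of s : forest_size (forest_of s) = \sum_(t <- s) tree_size t.
Proof.
rewrite /forest_of; elim: s => [|t s IH]; first by rewrite !big_nil forest_size1.
by rewrite !big_cons forest_sizeM forest_sizeU IH.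
Qed.

Lemma tree_size_gt0 t : 0 < tree_size t.
Proof.
by rewrite /tree_size lt0n size_eq0; apply/eqP => e; have := root_in_addresses (val t); rewrite e.
Qed.

Lemma in_finsupp_forest_of s t : (t \in finsupp (forest_of s)) = (t \in s).
Proof.
by rewrite mem_finsupp forest_ofE -has_pred1 has_count lt0n.
Qed.

Lemma forest_size_mem f t : t \in finsupp f -> tree_size t <= forest_size f.
Proof.
move=> tf; rewrite /forest_size (big_fsetD1 t) //=.
by apply: leq_trans (leq_addr _ _); rewrite leq_pmull // lt0n -mem_finsupp.
Qed.

Lemma forest_size_gt0 f : f != mone -> 0 < forest_size f.
Proof.
case: (fset_0Vmem (finsupp f)) => [f0|[t tf] _]; last first.
  by apply: leq_trans (forest_size_mem tf); apply: tree_size_gt0.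
move/eqP; case; apply/eqP/cmP => t; rewrite cm1.
by case: finsuppP => // ; rewrite f0 in_fset0.
Qed.

Lemma val_graft_of i s : exists2 s', perm_eq s' s &
  val (graft i (forest_of s)) = Node i (map val s').
Proof.
exists (sort (@tree_le d) (seq_of_forest (forest_of s))); last by [].
by rewrite perm_sort perm_seq_of_forest.
Qed.

Lemma tree_size_graft i s :
  tree_size (graft i (forest_of s)) = (\sum_(t <- s) tree_size t).+1.
Proof.
have [s' s's E] := val_graft_of i s.
by rewrite /tree_size E size_addresses big_map (perm_big _ s's).
Qed.

Lemma embeds_at_graft p0 i s1 s2 : embeds_seq p0 (map val s1) (map val s2) ->
  embeds_at 0 (val (graft i (forest_of s1))) (val (graft i (forest_of s2))).
Proof.
have [s1' s1s E1] := val_graft_of i s1; have [s2' s2s E2] := val_graft_of i s2.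
rewrite E1 E2 => s12; apply: (@embeds_at_node _ p0).
by apply: embeds_seq_perm s12; apply: perm_map => //; rewrite perm_sym.
Qed.

Lemma embeds_graft t i s : t \in s -> embeds t (graft i (forest_of s)).
Proof.
have [s' s's E] := val_graft_of i s => ts; exists 1; rewrite E.
by apply: embeds_at_child; apply: map_f; rewrite (perm_mem s's).
Qed.

Lemma embeds_trans t u v : embeds t u -> embeds u v -> embeds t v.
Proof. by move=> [c tu] [c' uv]; exists (c + c'); apply: embeds_at_trans tu uv. Qed.

Lemma embeds_refl t : embeds t t.
Proof. by exists 0; apply: embeds_at_refl. Qed.

End ForestSize.

(** * Support of the reduced coproduct *)

Section Support.
Variables (R : comNzRingType).

Definition supported (K : choiceType) (P : K -> Prop) (x : {malg R[K]}) : Prop :=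
  forall k, k \in msupp x -> P k.

Section Choice.
Variable (K : choiceType).
Implicit Types (P Q : K -> Prop) (x y : {malg R[K]}).

Lemma supported0 P : supported P 0.
Proof. by move=> k; rewrite msupp0 in_fset0. Qed.

Lemma supportedU P k : P k -> supported P (basis k).
Proof.
by move=> Pk l; rewrite unlock => /(fsubsetP msuppU_le); rewrite in_fset1 => /eqP->.
Qed.

Lemma supportedD P x y : supported P x -> supported P y -> supported P (x + y).
Proof.
by move=> xP yP k /(fsubsetP (msuppD_le x y)); rewrite in_fsetU => /orP[/xP|/yP].
Qed.

Lemma supportedB P x y : supported P x -> supported P y -> supported P (x - y).
Proof.
by move=> xP yP k /(fsubsetP (msuppB_le x y)); rewrite in_fsetU => /orP[/xP|/yP].
Qed.

Lemma supportedZ P a x : supported P x -> supported P (a *: x).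
Proof. by move=> xP k /(fsubsetP (msuppZ_le a x))/xP. Qed.

End Choice.

Lemma supported_linext (K L : choiceType) (h : K -> {malg R[L]})
    (P : K -> Prop) (Q : L -> Prop) x :
  supported P x -> (forall k, P k -> supported Q (h k)) -> supported Q (linext h x).
Proof.
move=> xP PQ; rewrite /linext big_seq.
elim/big_rec: _ => [|k y /xP/PQ kQ yQ]; first exact: supported0.
by apply: supportedD yQ; apply: supportedZ.
Qed.

Lemma supportedM (K : conomType) (P Q T : K -> Prop) (x y : {malg R[K]}) :
    supported P x -> supported Q y ->
  (forall k l, P k -> Q l -> T (mmul k l)) -> supported T (x * y).
Proof. by move=> xP yQ PQ k /msuppM_le [k1 [k2 [/xP P1 /yQ Q2 ->]]]; apply: PQ. Qed.

End Support.

Section CoproductSupport.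
Variables (R : comNzRingType) (d : nat).
Implicit Types (t u sigma : tree d) (s : seq (tree d)) (m : forest d * forest d).

(** Conditions met by admissible cuts: [m.1] is the pruned forest and [m.2] the trunk. The trunk is
    kept at depth 0 so that the condition survives grafting onto a new root. *)
Definition tree_cut sigma m : Prop :=
  [/\ (forest_size m.1 + forest_size m.2)%N = tree_size sigma,
      forall t, t \in finsupp m.1 -> embeds t sigma
    & m.2 = mone \/ exists2 t, m.2 = tree1 t & embeds_at 0 (val t) (val sigma)].

Definition forest_cut s m : Prop :=
  [/\ (forest_size m.1 + forest_size m.2)%N = (\sum_(t <- s) tree_size t)%N,
      forall t, t \in finsupp m.1 -> exists2 u, u \in s & embeds t u
    & exists2 s2, m.2 = forest_of s2 &
        forall p0, embeds_seq p0 (map val s2) (map val s)].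

Lemma forest_cut_nil : forest_cut [::] (mone, mone).
Proof.
split=> /=; first by rewrite !forest_size1 big_nil.
  by move=> t; rewrite mdom1 in_fset0.
by exists [::]; rewrite ?/forest_of ?big_nil // => p0; apply: embeds_seq_nil.
Qed.

Lemma forest_cut_cons t s m n : tree_cut t m -> forest_cut s n ->
  forest_cut (t :: s) (mmul m n).
Proof.
case: m n => [m1 m2] [n1 n2] [/= m_size m_emb m_root] [/= n_size n_emb [s2 s2E s2_emb]].
split=> /=.
- by rewrite !forest_sizeM addnACA m_size n_size big_cons.
- move=> u; rewrite mdomD in_fsetU => /orP[/m_emb tu|/n_emb[v vs uv]].
    by exists t; rewrite ?mem_head.
  by exists v; rewrite // inE vs orbT.
case: m_root => [->|[u -> tu]].
  by exists s2 => [|p0]; [rewrite mul1m | apply: embeds_seq_skip].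
exists (u :: s2) => [|p0]; first by rewrite s2E /forest_of big_cons.
exact: embeds_seq_cons.
Qed.

Lemma forest_cut_root s : forest_cut s (mone, forest_of s).
Proof.
split=> /=; first by rewrite forest_size1 forest_size_of.
  by move=> t; rewrite mdom1 in_fset0.
exists s => // p0; elim: s => [|t s IH]; first exact: embeds_seq_nil.
by apply: embeds_seq_cons IH; apply: embeds_at_refl.
Qed.

Lemma tree_cut_graft i s m : forest_cut s m ->
  tree_cut (graft i (forest_of s)) (m.1, tree1 (graft i m.2)).
Proof.
case: m => m1 m2 [/= m_size m_emb [s2 m2E s2_emb]]; split=> /=.
- by rewrite forest_sizeU m2E !tree_size_graft addnS -m_size m2E forest_size_of.
- by move=> t /m_emb[u us tu]; apply: embeds_trans tu _; apply: embeds_graft.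
- right; exists (graft i m2) => //; rewrite m2E.
  exact: embeds_at_graft (s2_emb (Node i [::])).
Qed.

Lemma supported_coproduct_forest s :
  (forall t, t \in s ->
     supported (tree_cut t) (coproduct (basis (tree1 t) : bck R d))) ->
  supported (forest_cut s) (coproduct (basis (forest_of s) : bck R d)).
Proof.
elim: s => [|t s IH] Hs.
  rewrite /forest_of big_nil coproductU coproduct_forest1 -basis1.
  by apply: supportedU; apply: forest_cut_nil.
rewrite /forest_of big_cons basisM rmorphM.
apply: supportedM (forest_cut_cons (t := t) (s := s)).
  by apply: Hs; rewrite mem_head.
by apply: IH => u us; apply: Hs; rewrite inE us orbT.
Qed.

(** Locating the support of the coproduct does not give coefficients. That subtracting 1 (x) sigma
    removes every term with empty left factor requires its own induction. *)
Definition left_proper m : Prop := m.1 != mone.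

Lemma left_properM m n : left_proper m \/ left_proper n -> left_proper (mmul m n).
Proof.
rewrite /left_proper => mn; apply/eqP => /= /unitm [m1 n1].
by case: mn; rewrite ?m1 ?n1 eqxx.
Qed.

Lemma supported_coproduct_forest_left s :
  (forall t, t \in s -> supported left_proper
     (coproduct (basis (tree1 t) : bck R d) - basis (mone, tree1 t))) ->
  supported left_proper
    (coproduct (basis (forest_of s) : bck R d) - basis (mone, forest_of s)).
Proof.
have split_diff (A : nzRingType) (a b c e : A) :
  a * b - c * e = (a - c) * b + c * (b - e) by rewrite mulrBl mulrBr addrA subrK.
elim: s => [|t s IH] Hs.
  rewrite /forest_of big_nil coproductU coproduct_forest1 -basis1 subrr.
  exact: supported0.
have Ht := Hs t (mem_head _ _).
have {}IH := IH (fun u us => Hs u (mem_behead (s := t :: s) us)).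
rewrite /forest_of big_cons basisM rmorphM.
have -> : (mone, mmul (tree1 t) (\big[mmul/mone]_(u <- s) tree1 u)) =
  mmul (mone, tree1 t) (mone, forest_of s) :> forest d * forest d.
  by congr (_, _); rewrite mul1m.
(* In each of the two products of the telescoped difference one factor is already left proper, and
   this passes to the product. *)
rewrite [X in _ - X]basisM split_diff; apply: supportedD.
  apply: (@supportedM _ _ left_proper (fun=> True)) => [||m n m1 _].
  - exact: Ht.
  - by [].
  - by apply: left_properM; left.
apply: (@supportedM _ _ (fun=> True) left_proper) => [||m n _ n1].
- by [].
- exact: IH.
- by apply: left_properM; right.
Qed.

Lemma graft_rightU i m :
  graft_right i (basis m) = basis (m.1, tree1 (graft i m.2)) :> bck2 R d.
Proof. exact: linextU. Qed.

Lemma supported_graft_right i (P Q : forest d * forest d -> Prop) (x : bck2 R d) :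
  supported P x -> (forall m, P m -> Q (m.1, tree1 (graft i m.2))) ->
  supported Q (graft_right i x).
Proof.
move=> xP PQ; apply: supported_linext xP _ => m Pm.
by apply: supportedU; apply: PQ.
Qed.

Lemma supported_coproduct_tree sigma :
  supported (tree_cut sigma) (coproduct (basis (tree1 sigma) : bck R d)) /\
  supported left_proper
    (coproduct (basis (tree1 sigma) : bck R d) - basis (mone, tree1 sigma)).
Proof.
elim/tree_graft_ind: sigma => i s IH.
rewrite coproduct_graft; split.
  apply: supportedD.
    apply: supportedU; split=> /=; last by left.
      by rewrite forest_sizeU forest_size1 addn0.
    move=> t; rewrite mdomU in_fset1 => /eqP->; exact: embeds_refl.
  apply: (@supported_graft_right _ (forest_cut s)); last exact: tree_cut_graft.
  by apply: supported_coproduct_forest => t /IH [].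
have -> : basis (mone, tree1 (graft i (forest_of s))) =
  graft_right i (basis (mone, forest_of s)) :> bck2 R d by rewrite graft_rightU.
have assoc (A : zmodType) (a b c : A) : a + b - c = a + (b - c) by rewrite addrA.
rewrite assoc -(linearB (graft_right i)); apply: supportedD.
  apply: supportedU; rewrite /left_proper /=; apply/eqP => /(congr1 (@forest_size d)).
  by rewrite forest_sizeU forest_size1 => e; have := tree_size_gt0 (graft i (forest_of s)); rewrite e.
apply: (@supported_graft_right _ left_proper) => //.
by apply: supported_coproduct_forest_left => t /IH [].
Qed.

Definition reduced_coproduct sigma : bck2 R d :=
  coproduct (basis (tree1 sigma)) - basis (tree1 sigma, mone) - basis (mone, tree1 sigma).

Definition proper_cut sigma m : Prop :=
  [/\ (forest_size m.1 + forest_size m.2)%N = tree_size sigma,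
      m.1 != mone, m.2 != mone,
      forall t, t \in finsupp m.1 -> embeds t sigma
    & forall t, t \in finsupp m.2 -> embeds t sigma].

Lemma tree1_neq1 t : tree1 t != mone.
Proof.
apply/eqP => /(congr1 (@forest_size d)); rewrite forest_sizeU forest_size1 => e.
by have := tree_size_gt0 t; rewrite e.
Qed.

(** sigma (x) 1 cancels the first term of the recursion. The rest is an image of [graft_right], so
    its right factors are trees, and the left factors are nonempty by [left_proper]. *)
Lemma supported_reduced_coproduct sigma :
  supported (proper_cut sigma) (reduced_coproduct sigma).
Proof.
elim/tree_graft_ind: sigma => i s _; rewrite /reduced_coproduct coproduct_graft.
have -> : basis (mone, tree1 (graft i (forest_of s))) =
  graft_right i (basis (mone, forest_of s)) :> bck2 R d by rewrite graft_rightU.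
have cancel (A : zmodType) (a b c : A) : a + b - a - c = b - c.
  by rewrite (addrAC a b) subrr add0r.
rewrite cancel -(linearB (graft_right i)).
apply: (@supported_graft_right _ (fun m => forest_cut s m /\ left_proper m)).
  move=> m mx; split; move: m mx; last first.
    by apply: supported_coproduct_forest_left => t _; apply: (proj2 (supported_coproduct_tree t)).
  apply: supportedB; last by apply: supportedU; apply: forest_cut_root.
  by apply: supported_coproduct_forest => t _; apply: (proj1 (supported_coproduct_tree t)).
move=> m [/(tree_cut_graft i) [sz emb root] m1]; split=> //=; first exact: tree1_neq1.
case: root => [/= /eqP|[t /= -> tu]]; first by rewrite (negbTE (tree1_neq1 _)).
by move=> u; rewrite mdomU in_fset1 => /eqP->; exists 0%N.
Qed.

End CoproductSupport.

(** * The bijection between rough paths and Hoelder families *)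

Section Defect.
Variables (R : realType) (d : nat).
Local Notation I := (unit_interval R).
Implicit Types (X Y : character R d) (sigma tau : tree d) (x y : tree d -> I -> I -> R).

Lemma tensorU X Y m : tensor X Y (basis m) = X (basis m.1) * Y (basis m.2).
Proof. by rewrite /tensor linextU. Qed.

Lemma star_tree X Y sigma : star X Y (basis (tree1 sigma)) =
  X (basis (tree1 sigma)) + Y (basis (tree1 sigma)) +
  tensor X Y (reduced_coproduct R sigma).
Proof.
rewrite /reduced_coproduct (linearB (tensor X Y)) (linearB (tensor X Y)) /=.
rewrite !tensorU /= !character_one mulr1 mul1r.
set a := X _; set b := Y _; rewrite -[LHS]/(tensor X Y (coproduct (basis (tree1 sigma)))).
set c := tensor _ _ _; have : a + b + (c - a - b) = c by lra.
by move->.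
Qed.

Lemma eq_tensor X X' Y Y' (P : forest d * forest d -> Prop) z : supported P z ->
  (forall m, P m -> X (basis m.1) * Y (basis m.2) = X' (basis m.1) * Y' (basis m.2)) ->
  tensor X Y z = tensor X' Y' z.
Proof.
by move=> zP XY; apply: eq_big_seq => m /zP Pm; congr (_ *: _); apply: XY.
Qed.

(** The sizes of two nonempty factors add up to that of [sigma]. Every induction on tree size below
    rests on this strict decrease. *)
Lemma proper_cut_size sigma m t : proper_cut sigma m ->
  t \in finsupp m.1 \/ t \in finsupp m.2 ->
  embeds t sigma /\ (tree_size t < tree_size sigma)%N.
Proof.
move=> [<- m1 m2 e1 e2] [] tm; split; first exact: e1.
- by rewrite -addn1 leq_add ?forest_size_mem ?forest_size_gt0.
- exact: e2.
- by rewrite -add1n leq_add ?forest_size_mem ?forest_size_gt0.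
Qed.

Lemma eq_tensor_reduced X X' Y Y' sigma :
  (forall t, embeds t sigma -> (tree_size t < tree_size sigma)%N ->
     X (basis (tree1 t)) = X' (basis (tree1 t)) /\
     Y (basis (tree1 t)) = Y' (basis (tree1 t))) ->
  tensor X Y (reduced_coproduct R sigma) = tensor X' Y' (reduced_coproduct R sigma).
Proof.
move=> XY; apply: eq_tensor (@supported_reduced_coproduct R d sigma) _ => m cut_m.
rewrite ![_ (basis m.1)]character_basis ![_ (basis m.2)]character_basis.
congr (_ * _); apply: eq_forest_eval => t tm.
  by have [] := proper_cut_size cut_m (or_introl tm) => e /(XY _ e) [].
by have [] := proper_cut_size cut_m (or_intror tm) => e /(XY _ e) [].
Qed.

Definition path_char x (s t : I) : character R d := tree_char (fun tau => x tau s t).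

Definition defect x sigma (s u t : I) : R :=
  tensor (path_char x s u) (path_char x u t) (reduced_coproduct R sigma).

Definition chen x sigma := forall s u t,
  x sigma s t = x sigma s u + x sigma u t + defect x sigma s u t.

Lemma star_path_char x sigma s u t :
  star (path_char x s u) (path_char x u t) (basis (tree1 sigma)) =
  x sigma s u + x sigma u t + defect x sigma s u t.
Proof. by rewrite star_tree !tree_charE. Qed.

Lemma chenP x : (forall sigma, chen x sigma) <->
  (forall s u t, star (path_char x s u) (path_char x u t) = path_char x s t).
Proof.
split=> [ch s u t|st sigma s u t].
  by apply: character_trees_ext => tau; rewrite star_path_char tree_charE -ch.
by rewrite -star_path_char st tree_charE.
Qed.

Lemma eq_defect x y sigma :
  (forall tau, embeds tau sigma -> (tree_size tau < tree_size sigma)%N -> x tau = y tau) ->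
  defect x sigma = defect y sigma.
Proof.
move=> xy; apply/funext => s; apply/funext => u; apply/funext => t.
by apply: eq_tensor_reduced => tau e1 e2; rewrite !tree_charE xy.
Qed.

(* Evaluate [starA] at [sigma]: the values of [x] at [sigma] itself cancel. *)
Lemma defect_cocycle x sigma :
  (forall tau, (tree_size tau < tree_size sigma)%N -> chen x tau) ->
  forall s u t v, defect x sigma s u t + defect x sigma s t v =
                  defect x sigma u t v + defect x sigma s u v.
Proof.
move=> ch s u t v.
have := congr1 (fun X : character R d => X (basis (tree1 sigma)))
  (starA (path_char x s u) (path_char x u t) (path_char x t v)).
rewrite star_tree star_path_char tree_charE.
rewrite [RHS]star_tree star_path_char tree_charE.
have -> : tensor (star (path_char x s u) (path_char x u t)) (path_char x t v)
    (reduced_coproduct R sigma) = defect x sigma s t v.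
  apply: eq_tensor_reduced => tau _ /ch chx; split=> //.
  by rewrite star_path_char [in RHS]tree_charE -chx.
have -> : tensor (path_char x s u) (star (path_char x u t) (path_char x t v))
    (reduced_coproduct R sigma) = defect x sigma s u v.
  apply: eq_tensor_reduced => tau _ /ch chx; split=> //.
  by rewrite star_path_char [in RHS]tree_charE -chx.
by move=> e; lra.
Qed.

End Defect.

(** * Hoelder bounds for the defect *)

Section Bounds.
Variables (R : realType) (d : nat) (gamma : R).
Hypothesis gamma_gt0 : 0 < gamma.
Local Notation I := (unit_interval R).
Implicit Types (sigma tau : tree d) (x y : tree d -> I -> I -> R) (f : forest d).

Definition tree_bound x tau := exists C : R, forall s t,
  `|x tau s t| <= C * `|val t - val s| `^ (gamma * (tree_size tau)%:R).

Lemma powR_gammaD l m n : 0 <= l ->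
  l `^ (gamma * (m + n)%:R) = l `^ (gamma * m%:R) * l `^ (gamma * n%:R).
Proof.
move=> l0; rewrite natrD mulrDr.
have [->|l_neq0] := eqVneq l 0; last by rewrite powRD // l_neq0 implybT.
(* At [l = 0] the addition law for powers is checked by hand: 0 to the power 0 is 1, and for [m > 0]
   both sides vanish. *)
case: m => [|m]; first by rewrite mulr0 add0r powRr0 mul1r.
have gm_gt0 : 0 < gamma * m.+1%:R by rewrite mulr_gt0 ?ltr0Sn.
have gmn_gt0 : 0 < gamma * m.+1%:R + gamma * n%:R.
  by rewrite ltr_wpDr // mulr_ge0 // ltW.
by rewrite (powR0 (lt0r_neq0 gm_gt0)) (powR0 (lt0r_neq0 gmn_gt0)) mul0r.
Qed.

(** The bound holds for every [l] above the distance, so that factors over the intervals s, u and u,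
    t can be multiplied with a common [l]. *)
Lemma forest_bound x f : (forall t, t \in finsupp f -> tree_bound x t) ->
  exists2 C : R, 0 <= C & forall l s t, `|val t - val s| <= l ->
    `|path_char x s t (basis f)| <= C * l `^ (gamma * (forest_size f)%:R).
Proof.
rewrite -[f]seq_of_forestK => xb.
have {}xb t : t \in seq_of_forest f -> tree_bound x t.
  by move=> tf; apply: xb; rewrite in_finsupp_forest_of.
rewrite /forest_of; elim: (seq_of_forest f) xb => [|t r IH] xb.
  exists 1 => // l s t _; rewrite big_nil tree_charU forest_eval1 forest_size1.
  by rewrite mulr0 powRr0 mulr1 normr1.
have [|C C0 rC] := IH; first by move=> u ur; apply: xb; rewrite inE ur orbT.
have [D tD] := xb t (mem_head _ _).
exists (`|D| * C) => [|l s u su]; first by rewrite mulr_ge0.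
rewrite big_cons basisM characterM normrM forest_sizeM forest_sizeU.
have l0 : 0 <= l by apply: le_trans su.
rewrite powR_gammaD // mulrACA; apply: ler_pM => //; last exact: rC.
rewrite tree_charE; apply: le_trans (tD s u) _.
apply: le_trans (ler_wpM2r (powR_ge0 _ _) (ler_norm D)) _.
apply: ler_wpM2l => //; apply: ge0_ler_powR; rewrite ?nnegrE //.
by rewrite mulr_ge0 // ltW.
Qed.

Lemma defect_bound x sigma :
  (forall tau, (tree_size tau < tree_size sigma)%N -> tree_bound x tau) ->
  exists K : R, forall l s u t, `|val u - val s| <= l -> `|val t - val u| <= l ->
    `|defect x sigma s u t| <= K * l `^ (gamma * (tree_size sigma)%:R).
Proof.
move=> xb; have := @supported_reduced_coproduct R d sigma.
rewrite /defect /tensor /linext; set z := reduced_coproduct R sigma => zP.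
(* The sum over the support is generalised to any list inside it, for induction; each term has total
   degree [tree_size sigma]. *)
suff: forall r : seq (forest d * forest d), {subset r <= msupp z} ->
    exists K : R, forall l s u t, `|val u - val s| <= l -> `|val t - val u| <= l ->
    `|\sum_(m <- r) z@_m *: (path_char x s u (basis m.1) * path_char x u t (basis m.2) : R^o)|
      <= K * l `^ (gamma * (tree_size sigma)%:R) by apply.
elim=> [|m r IH] rz.
  exists 0 => l s u t _ _; rewrite big_nil mul0r normr0 //.
have [|K rK] := IH; first by move=> k kr; apply: rz; rewrite inE kr orbT.
have cut_m : proper_cut sigma m by apply/zP/rz/mem_head.
have [C C0 mC] : exists2 C : R, 0 <= C & forall l s t, `|val t - val s| <= l ->
    `|path_char x s t (basis m.1)| <= C * l `^ (gamma * (forest_size m.1)%:R).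
  apply: forest_bound => t tm; apply: xb.
  by have [] := proper_cut_size cut_m (or_introl tm).
have [D D0 mD] : exists2 C : R, 0 <= C & forall l s t, `|val t - val s| <= l ->
    `|path_char x s t (basis m.2)| <= C * l `^ (gamma * (forest_size m.2)%:R).
  apply: forest_bound => t tm; apply: xb.
  by have [] := proper_cut_size cut_m (or_intror tm).
exists (`|z@_m| * (C * D) + K) => l s u t su ut.
rewrite big_cons; apply: le_trans (ler_normD _ _) _; rewrite mulrDl; apply: lerD.
  rewrite -[_ *: _]/(z@_m * (_ * _)) normrM -mulrA; apply: ler_wpM2l => //; have [<- _ _ _ _] := cut_m.
  have l0 : 0 <= l by apply: le_trans su.
  by rewrite powR_gammaD // mulrACA normrM; apply: ler_pM => //; [apply: mC | apply: mD].
exact: rK.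
Qed.

End Bounds.

Section Sewing.
Variable R : realType.
Local Notation I := (unit_interval R).

Definition sews (a : R) (W : I -> I -> I -> R) (e : I -> I -> R) : Prop :=
  (forall s u t, e s t = e s u + e u t + W s u t) /\
  exists C, forall s t, `|e s t| <= C * `|val t - val s| `^ a.

(* As [xget] sees only [a] and [W], equal defects receive equal solutions; this is
   what makes the action local. *)
Definition sewing (a : R) (W : I -> I -> I -> R) : I -> I -> R :=
  xget (fun _ _ => 0) [set e | sews a W e].

Lemma sewingP a W : (exists e, sews a W e) -> sews a W (sewing a W).
Proof. by move=> [e eP]; rewrite /sewing; case: xgetP => // /(_ e). Qed.

End Sewing.

(** * Lifting a Hoelder family to a rough path and recovering it *)

Section Lift.
Variables (R : realType) (d : nat) (gamma : R).
Hypothesis gamma01 : 0 < gamma < 1.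
Hypothesis gammaV_nat : gamma^-1 \isn't a Num.nat.
Local Notation I := (unit_interval R).
Local Notation trees_upto := (trees_upto d gamma).
Local Notation holder_group := (holder_group d gamma).
Local Notation brp := (branched_rough_path d gamma).
Local Notation tree_bound := (tree_bound gamma).
Implicit Types (sigma tau : tree d) (x y : tree d -> I -> I -> R)
  (g h : holder_group) (X Y : brp).

Let gamma_gt0 : 0 < gamma. Proof. by have /andP[] := gamma01. Qed.

(** Trees with more than N nodes carry no function: the value 0 makes the path agree there with the
    sewing solution, which is unique at order above 1. *)
Definition increment g sigma (s t : I) : R :=
  if insub sigma is Some tau then g tau t - g tau s else 0.

Definition canonical x sigma : I -> I -> R :=
  sewing (gamma * (tree_size sigma)%:R) (defect x sigma).

(** The graph of the bijection. Since [canonical x sigma] reads [x] only on smaller trees, it is a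
    recursive definition of [x] by size. *)
Definition solves g x := forall sigma s t,
  x sigma s t = canonical x sigma s t + increment g sigma s t.

Lemma canonicalP x sigma :
  (forall tau, (tree_size tau < tree_size sigma)%N -> chen x tau /\ tree_bound x tau) ->
  sews (gamma * (tree_size sigma)%:R) (defect x sigma) (canonical x sigma).
Proof.
move=> IH; apply: sewingP.
have [|K WK] := @defect_bound R d gamma gamma_gt0 x sigma; first by move=> tau /IH[].
apply: holder_sewing WK => //.
- by rewrite mulr_gt0 // ltr0n tree_size_gt0.
(* Order 1 would make gamma^-1 the natural number [tree_size sigma]. *)
- apply: contraNneq gammaV_nat => e.
  have -> : gamma^-1 = (tree_size sigma)%:R; last exact: natr_nat.
  by apply: (mulfI (lt0r_neq0 gamma_gt0)); rewrite e divff // lt0r_neq0.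
- by apply: defect_cocycle => tau /IH[].
Qed.

Lemma eq_canonical x y sigma :
  (forall tau, embeds tau sigma -> (tree_size tau < tree_size sigma)%N -> x tau = y tau) ->
  canonical x sigma = canonical y sigma.
Proof. by move=> xy; rewrite /canonical (eq_defect xy). Qed.

Lemma tree_size_ind (P : tree d -> Prop) :
  (forall sigma, (forall tau, (tree_size tau < tree_size sigma)%N -> P tau) -> P sigma) ->
  forall sigma, P sigma.
Proof.
move=> IH sigma; have [n] := ubnP (tree_size sigma).
elim: n sigma => // n IHn sigma sn; apply: IH => tau ts; apply: IHn.
exact: leq_trans ts sn.
Qed.

Lemma solves_unique g x y : solves g x -> solves g y -> x = y.
Proof.
move=> gx gy; apply/funext; elim/tree_size_ind => sigma IH.
apply/funext => s; apply/funext => t; rewrite gx gy.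
by rewrite (@eq_canonical x y) // => tau _ /IH.
Qed.

(** The [n]-th iterate of the recursion step no longer changes on trees with at most [n] nodes, so
    each tree is read at the iterate of its own size. *)
Lemma solves_exists g : exists x, solves g x.
Proof.
pose step x sigma s t := canonical x sigma s t + increment g sigma s t.
pose xs n := iter n step (fun _ _ _ => 0).
have xsS n : xs n.+1 = step (xs n) by [].
have stable sigma n : (tree_size sigma <= n)%N -> xs n sigma = xs (tree_size sigma) sigma.
  elim/tree_size_ind: sigma n => sigma IH n sn.
  case: n sn => [|n]; first by rewrite leqNgt tree_size_gt0.
  have := tree_size_gt0 sigma; case sE: (tree_size sigma) => [//|k] _ kn; rewrite !xsS.
  apply/funext => s; apply/funext => t; rewrite /step; congr (_ s t + _).
  apply: eq_canonical => tau _ ts; have tk : (tree_size tau <= k)%N.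
    by move: ts; rewrite sE ltnS.
  by rewrite (IH tau ts n) ?(IH tau ts k) // (leq_trans tk).
exists (fun sigma => xs (tree_size sigma) sigma) => sigma s t.
have := tree_size_gt0 sigma; case sE: (tree_size sigma) => [//|k] _; rewrite xsS {1}/step; congr (_ s t + _); apply: eq_canonical => tau _.
by rewrite sE ltnS => /stable.
Qed.

Lemma holder_groupP g (tau : trees_upto) :
  holder (gamma * (tree_size (val tau))%:R) (g tau) /\ g tau (unit_interval0 R) = 0.
Proof. by have := valP g; rewrite inE => /(_ tau). Qed.

Lemma increment_bound g sigma : exists C, forall s t,
  `|increment g sigma s t| <= C * `|val t - val s| `^ (gamma * (tree_size sigma)%:R).
Proof.
rewrite /increment; case: insubP => [tau _ tauE|_].
  by have [[C gC] _] := holder_groupP g tau; exists C => s t; rewrite -tauE.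
by exists 0 => s t; rewrite normr0 mul0r.
Qed.

Lemma incrementD g sigma s u t :
  increment g sigma s t = increment g sigma s u + increment g sigma u t.
Proof. by rewrite /increment; case: insubP => *; lra. Qed.

Lemma solves_chen g x : solves g x ->
  forall sigma, chen x sigma /\ tree_bound x sigma.
Proof.
move=> gx; elim/tree_size_ind => sigma /canonicalP [cW [C cC]]; split.
  by move=> s u t; rewrite !gx (cW s u t) (incrementD g sigma s u t); lra.
have [D gD] := increment_bound g sigma; exists (C + D) => s t; rewrite gx.
by apply: le_trans (ler_normD _ _) _; rewrite mulrDl; apply: lerD.
Qed.

Section MakeLift.
Variables (x : tree d -> I -> I -> R).
Hypothesis x_ok : forall sigma, chen x sigma /\ tree_bound x sigma.

Lemma make_brp_star s u t : star (path_char x s u) (path_char x u t) = path_char x s t.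
Proof. by apply: (chenP x).1 => sigma; have [] := x_ok sigma. Qed.

Lemma make_brp_bound (f : forest d) : exists C : R, forall s t,
  `|path_char x s t (basis f)| <= C * `|val t - val s| `^ (gamma * (forest_size f)%:R).
Proof.
have [|C C0 xC] := @forest_bound R d gamma gamma_gt0 x f.
  by move=> t _; have [] := x_ok t.
by exists C => s t; apply: xC.
Qed.

Definition make_brp : brp := BranchedRoughPath make_brp_star make_brp_bound.

End MakeLift.

Definition tree_values X sigma (s t : I) : R := X s t (basis (tree1 sigma)).

Lemma tree_values_inj : injective tree_values.
Proof.
move=> X Y XY; have : brp_val X = brp_val Y.
  apply/funext => s; apply/funext => t; apply: character_trees_ext => sigma.
  exact: (congr1 (fun x => x sigma s t) XY).
case: X Y {XY} => [X X1 X2] [Y Y1 Y2] /= XY; subst Y.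
by rewrite (Prop_irrelevance X1 Y1) (Prop_irrelevance X2 Y2).
Qed.

Lemma path_char_values X s t : path_char (tree_values X) s t = X s t.
Proof. exact: tree_charK. Qed.

Lemma tree_values_ok X sigma : chen (tree_values X) sigma /\ tree_bound (tree_values X) sigma.
Proof.
split.
  move: sigma; apply/chenP => s u t; rewrite !path_char_values.
  by case: X.
case: X => X X1 X2; have [C XC] := X2 (tree1 sigma); exists C => s t.
by have := XC s t; rewrite forest_sizeU.
Qed.

Lemma tree_values_make x x_ok : tree_values (@make_brp x x_ok) = x.
Proof.
apply/funext => sigma; apply/funext => s; apply/funext => t.
exact: tree_charE.
Qed.

Lemma lift_exists g : exists X, solves g (tree_values X).
Proof.
have [x gx] := solves_exists g; exists (make_brp (solves_chen gx)).
by rewrite tree_values_make.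
Qed.

Definition remainder x sigma s t := x sigma s t - canonical x sigma s t.

Lemma remainderD X sigma s u t : remainder (tree_values X) sigma s t =
  remainder (tree_values X) sigma s u + remainder (tree_values X) sigma u t.
Proof.
rewrite /remainder; have [ch _] := tree_values_ok X sigma.
have [cW _] := @canonicalP (tree_values X) sigma (fun tau _ => tree_values_ok X tau).
by rewrite (ch s u t) (cW s u t); lra.
Qed.

Lemma remainder_bound X sigma : exists C, forall s t,
  `|remainder (tree_values X) sigma s t| <=
    C * `|val t - val s| `^ (gamma * (tree_size sigma)%:R).
Proof.
rewrite /remainder; have [_ [C xC]] := tree_values_ok X sigma.
have [_ [D cD]] := @canonicalP (tree_values X) sigma (fun tau _ => tree_values_ok X tau).
exists (C + D) => s t; apply: le_trans (ler_normB _ _) _.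
by rewrite mulrDl; apply: lerD.
Qed.

Lemma unlift_exists X : exists g, solves g (tree_values X).
Proof.
set x := tree_values X; pose t0 := unit_interval0 R.
(* The remainder is additive, hence the increment of its section from 0, which vanishes at 0 as
   required. *)
pose g (tau : trees_upto) t := remainder x (val tau) t0 t.
have rE sigma s t : remainder x sigma s t = remainder x sigma t0 t - remainder x sigma t0 s.
  by rewrite (remainderD X sigma t0 s t); lra.
have gP : g \in @holder_family R d gamma.
  rewrite inE => tau; split.
    have [C rC] := remainder_bound X (val tau); exists C => s t.
    by rewrite /g -rE; apply: rC.
  by rewrite /g; have := remainderD X (val tau) t0 t0 t0; rewrite -/x; lra.
exists (HolderGroup gP) => sigma s t.
suff : remainder x sigma s t = increment (HolderGroup gP) sigma s t.
  by rewrite /remainder => <-; lra.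
rewrite /increment; case: insubP => [tau _ tauE|]; first by rewrite rE -tauE.
(* More than N nodes means [tree_size sigma > gamma^-1], that is, order above 1, where an additive
   remainder is zero. *)
rewrite -ltnNge => sN; have [C rC] := remainder_bound X sigma.
apply: holder_additive_eq0 (remainderD X sigma) rC _ _.
rewrite -ltr_pdivrMl // mulr1 -truncn_lt_nat // invr_ge0 ltW //.
Qed.

(** Increments determine each function up to a constant, fixed by its value 0 at 0. *)
Lemma solves_group_unique g h x : solves g x -> solves h x -> g = h.
Proof.
move=> gx hx; apply: val_inj; apply/funext => tau; apply/funext => t.
have := gx (val tau) (unit_interval0 R) t; rewrite hx => /addrI.
rewrite /increment valK.
have [_ ->] := holder_groupP g tau; have [_ ->] := holder_groupP h tau.
by rewrite !subr0.
Qed.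

Definition lift g : brp := projT1 (cid (lift_exists g)).
Definition unlift X : holder_group := projT1 (cid (unlift_exists X)).

Lemma lift_solves g : solves g (tree_values (lift g)).
Proof. exact: projT2 (cid (lift_exists g)). Qed.

Lemma unlift_solves X : solves (unlift X) (tree_values X).
Proof. exact: projT2 (cid (unlift_exists X)). Qed.

Lemma liftK : cancel lift unlift.
Proof.
by move=> g; apply: solves_group_unique (unlift_solves _) (lift_solves g).
Qed.

Lemma unliftK : cancel unlift lift.
Proof.
by move=> X; apply/tree_values_inj/(solves_unique (lift_solves _)); apply: unlift_solves.
Qed.

(** If [sigma] does not contain [tau], neither do the trees embedded in it, so the canonical parts
    agree by induction, and [sigma] differs from [tau]. At [tau] itself the trees involved are too
    small to contain it, and only the increments differ. *)
Lemma solves_local g h x y (tau : trees_upto) : solves g x -> solves h y ->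
    (forall tau' : trees_upto, tau' != tau -> g tau' = h tau') ->
  (forall sigma, ~ contains sigma (val tau) -> x sigma = y sigma) /\
  (forall s t, x (val tau) s t - (g tau t - g tau s) = y (val tau) s t - (h tau t - h tau s)).
Proof.
move=> gx hy gh.
have local sigma : ~ contains sigma (val tau) -> x sigma = y sigma.
  elim/tree_size_ind: sigma => sigma IH Nc.
  apply/funext => s; apply/funext => t; rewrite gx hy; congr (_ s t + _).
    apply: eq_canonical => rho rs /IH; apply => rt.
    exact: Nc (contains_embeds rt rs).
  rewrite /increment; case: insubP => // tau' _ tauE; rewrite gh //.
  apply/eqP => tt; apply: Nc; rewrite -tauE tt; exact: contains_refl.
split=> // s t; rewrite gx hy /increment valK.
rewrite (@eq_canonical x y (val tau)) ?addrK // => rho _ rs; apply: local.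
by move=> /contains_size; rewrite leqNgt rs.
Qed.

End Lift.

Theorem corollary1p3 (R : realType) (d : nat) (hd : (0 < d)%N) (gamma : R)
    (hgamma : 0 < gamma < 1) (hN : gamma^-1 \isn't a Num.nat) :
  exists act : holder_group d gamma -> branched_rough_path d gamma ->
               branched_rough_path d gamma,
    ((forall X, act 0 X = X) /\ (forall g h X, act (g + h) X = act g (act h X))) /\
    (forall (g : holder_group d gamma) (tau : trees_upto d gamma),
       (exists t, g tau t != 0) ->
       (forall tau' : trees_upto d gamma, tau' != tau -> forall t, g tau' t = 0) ->
       forall X : branched_rough_path d gamma,
         (forall s t, act g X s t (basis (tree1 (val tau))) =
                      X s t (basis (tree1 (val tau))) + g tau t - g tau s) /\
         (forall sigma : tree d, ~ contains sigma (val tau) ->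
            forall s t, act g X s t (basis (tree1 sigma)) =
                        X s t (basis (tree1 sigma)))) /\
    (forall X, bijective (fun g => act g X)).
Proof.
pose Lift := lift (d := d) hgamma hN; pose Unlift := unlift (d := d) hgamma hN.
have LK : cancel Lift Unlift by apply: liftK.
have UK : cancel Unlift Lift by apply: unliftK.
(* Translation in the coordinates given by [Unlift]. *)
exists (fun g X => Lift (g + Unlift X)); split; [split|split].
- by move=> X; rewrite add0r UK.
- by move=> g h X; rewrite LK addrA.
- move=> g tau _ g0 X.
  have [|||local inc] := @solves_local R d gamma (g + Unlift X) (Unlift X)
      (tree_values (Lift (g + Unlift X))) (tree_values X) tau.
  - exact: lift_solves.
  - exact: unlift_solves.
  - move=> tau' /g0 g0'; apply/funext => t.
    by rewrite -[LHS]/(g tau' t + Unlift X tau' t) g0' add0r.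
  split=> [s t|sigma /local e s t]; last exact: (congr1 (fun x => x s t) e).
  have := inc s t.
  rewrite -[(g + Unlift X) tau t]/(g tau t + Unlift X tau t).
  rewrite -[(g + Unlift X) tau s]/(g tau s + Unlift X tau s) /tree_values.
  by move=> e; lra.
(* The group element carrying [X] to [Y] is the difference of their coordinates. *)
- move=> X; exists (fun Y => Unlift Y - Unlift X) => [g|Y].
    by rewrite LK addrK.
  by rewrite subrK UK.
Qed.
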